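(* For every $n\ge1$, $k\ge 1$ and $\lambda\vdash n$, $$s_\lambda\!\left[\frac{1}{(1-q_1)\cdots(1-q_k)}\right]=\frac{\sum_{T\in\mathrm{SYT}(\lambda)}\sum_{\vec{\sigma}\in S_n^{\times(k-1)}} q_1^{\mathrm{comaj}^1_T(\vec{\sigma})}\cdots q_k^{\mathrm{comaj}^k_T(\vec{\sigma})}}{(q_1;q_1)_n\cdots(q_k;q_k)_n}.$$
   Context: $s_\lambda[1/((1-q_1)\cdots(1-q_k))]$ denotes the Schur function $s_\lambda$ evaluated at the infinitely many variables given by all monomials $q_1^{a_1}\cdots q_k^{a_k}$, $(a_1,\dots,a_k)\in\mathbb{N}^k$ (a formal power series). $(q;t)_r=(1-q)(1-qt)\cdots(1-qt^{r-1})$. $\mathrm{SYT}(\lambda)$ is the set of standard Young tableaux of shape $\lambda$; $\epsilon$ is the identity of $S_n$. Definitions. $\mathbb{N}=\{0,1,2,\dots\}$. Sequences in $\mathbb{N}^r$ are compared lexicographically. For $R\subseteq\{1,\dots,n-1\}$ and distinct $a,b\in\{1,\dots,n\}$, write $a\sim_R b$ if all of $\min(a,b),\dots,\max(a,b)-1$ lie in $R$. For $S=(s^1,\dots,s^n)\in(\mathbb{N}^r)^n$ (if $r=0$, all $s^i$ are empty and equal) and $\sigma=\sigma_1\cdots\sigma_n\in S_n$, $\mathrm{Des}_{R,S}(\sigma)$ is the set of $i\in\{1,\dots,n-1\}$ such that either $s^{\sigma_i}>s^{\sigma_{i+1}}$, or $s^{\sigma_i}=s^{\sigma_{i+1}}$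 and either ($\sigma_{i+1}<\sigma_i$ and not $\sigma_{i+1}\sim_R\sigma_i$) or ($\sigma_{i+1}>\sigma_i$ and $\sigma_i\sim_R\sigma_{i+1}$). $\mathrm{Comaj}_{R,S}(\sigma)=\sum_{i\in\mathrm{Des}_{R,S}(\sigma)}(n-i)$. $Z_{R,\sigma}(S)=(z^1,\dots,z^n)\in(\mathbb{N}^{r+1})^n$, where $z^j$ is $s^j$ with a first coordinate $z^j_1$ prepended, $z^{\sigma_i}_1=\#\{j<i: j\in\mathrm{Des}_{R,S}(\sigma)\}$. For $\vec{\pi}=(\pi^1,\dots,\pi^{k-1})\in S_n^{\times(k-1)}$ set $\pi^k=\epsilon$, $Z^0=$ list of $n$ empty sequences, $Z^i=Z_{R,\pi^i}(Z^{i-1})$, and $\mathrm{comaj}^i_R(\vec{\pi})=\mathrm{Comaj}_{R,Z^{i-1}}(\pi^i)$ for $1\le i\le k$. For a standard tableau $T$ with $n$ cells, $\mathrm{des}(T)$ is the set of $i$ such that $i+1$ lies in a strictly lower row than $i$ (English notation), and $\mathrm{comaj}^i_T=\mathrm{comaj}^i_{\mathrm{des}(T)}$. *)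

(* Defs.v *)
From HB Require Import structures.
From mathcomp Require Import all_boot all_order all_algebra all_fingroup.
Set Implicit Arguments. Unset Strict Implicit. Unset Printing Implicit Defensive.
Import GRing.Theory.

Definition is_partition (n : nat) (la : seq nat) : bool :=
  [&& sorted geq la, all (fun p => 0 < p) la & sumn la == n].

(* cells (row, column), 0-based; a partition of n fits in an n x n grid *)
Notation cell n := ('I_n * 'I_n)%type.

Definition in_shape (la : seq nat) (n : nat) (x : cell n) : bool :=
  x.2 < nth 0 la x.1.

Fixpoint lex_lt (s t : seq nat) : bool :=
  match s, t with
  | x :: s', y :: t' => (x < y) || ((x == y) && lex_lt s' t')
  | _, _ => false
  end.
Definition lex_le (s t : seq nat) : bool := (s == t) || lex_lt s t.

(* The alphabet is the set of monomials q^a, a in N^k, totally ordered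
   lexicographically; s_la is the generating function of semistandard
   tableaux of shape la with entries in this alphabet.  The coefficient of
   q^d counts SSYT whose entries (exponent vectors) sum to d; every
   coordinate of every entry is then <= d_t <= sum d, so entries can be taken
   in 'I_k -> 'I_(sum d).+1 without loss. *)
Definition entry_seq (k D : nat) (e : {ffun 'I_k -> 'I_D}) : seq nat :=
  [seq val (e t) | t <- enum 'I_k].

Definition is_SSYT (n k D : nat) (la : seq nat)
    (F : {ffun cell n -> {ffun 'I_k -> 'I_D}}) : bool :=
  [&& [forall x : cell n, ~~ in_shape la x ==> [forall t, val (F x t) == 0]],
      [forall x : cell n, forall y : cell n,
         [&& in_shape la x, in_shape la y, (x.1 == y.1 :> nat)
           & (y.2 == (x.2).+1 :> nat)] ==>
         lex_le (entry_seq (F x)) (entry_seq (F y))]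
    & [forall x : cell n, forall y : cell n,
         [&& in_shape la x, in_shape la y, (y.1 == (x.1).+1 :> nat)
           & (x.2 == y.2 :> nat)] ==>
         lex_lt (entry_seq (F x)) (entry_seq (F y))]].

Definition ssyt_weight (n k D : nat) (la : seq nat)
    (F : {ffun cell n -> {ffun 'I_k -> 'I_D}}) (t : 'I_k) : nat :=
  \sum_(x : cell n | in_shape la x) val (F x t).

Definition schur_coef (n k : nat) (la : seq nat) (d : 'I_k -> nat) : nat :=
  #|[set F : {ffun cell n -> {ffun 'I_k -> 'I_(\sum_(t < k) d t).+1}} |
      is_SSYT la F && [forall t, ssyt_weight la F t == d t]]|.

Definition ps (k : nat) := ('I_k -> nat) -> int.

Definition ps_mul (k : nat) (f g : ps k) : ps k := fun d =>
  (\sum_(e : {ffun 'I_k -> 'I_(\sum_(t < k) d t).+1} | [forall t, (e t <= d t)%N])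
     f (fun t => val (e t)) * g (fun t => (d t - e t)%N))%R.

Definition schur_ps (n k : nat) (la : seq nat) : ps k :=
  fun d => Posz (schur_coef n la d).

Definition qpoch (n : nat) : {poly int} := (\prod_(j < n) (1 - 'X^(j.+1)))%R.

Definition qpoch_den (n k : nat) : ps k :=
  fun d => (\prod_(t < k) (qpoch n)`_(d t))%R.

Definition is_SYT (n : nat) (la : seq nat) (T : {ffun cell n -> 'I_n.+1}) : bool :=
  [&& [forall x : cell n, ~~ in_shape la x ==> (val (T x) == 0)],
      [forall x : cell n, in_shape la x ==> (0 < val (T x))],
      [forall x : cell n, forall y : cell n,
         [&& in_shape la x, in_shape la y & T x == T y] ==> (x == y)],
      [forall x : cell n, forall y : cell n,
         [&& in_shape la x, in_shape la y, (x.1 == y.1 :> nat)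
           & (y.2 == (x.2).+1 :> nat)] ==> (val (T x) < val (T y))]
    & [forall x : cell n, forall y : cell n,
         [&& in_shape la x, in_shape la y, (y.1 == (x.1).+1 :> nat)
           & (x.2 == y.2 :> nat)] ==> (val (T x) < val (T y))]].

(* row (0-based, top row = 0) of the cell containing v *)
Definition row_of (n : nat) (la : seq nat) (T : {ffun cell n -> 'I_n.+1}) (v : nat) : nat :=
  if [pick x : cell n | in_shape la x && (val (T x) == v)] is Some x then val x.1 else 0.

Definition des_set (n : nat) (la : seq nat) (T : {ffun cell n -> 'I_n.+1}) : pred nat :=
  fun i => (0 < i < n) && (row_of la T i < row_of la T i.+1).

(* Words: a permutation sigma is given by its one-line word sigma_1...sigma_n
   (values 1..n, sigma_i = nth 0 w (i-1)); S = (s^1,...,s^n) with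
   s^j = nth [::] S (j-1).  R is a predicate on {1..n-1}. *)

Definition simR (R : pred nat) (a b : nat) : bool :=
  all R (iota (minn a b) (maxn a b - minn a b)).

Definition is_des (R : pred nat) (S : seq (seq nat)) (w : seq nat) (i : nat) : bool :=
  let a := nth 0 w i.-1 in let b := nth 0 w i in
  let sa := nth [::] S a.-1 in let sb := nth [::] S b.-1 in
  lex_lt sb sa ||
  ((sa == sb) && (((b < a) && ~~ simR R b a) || ((a < b) && simR R a b))).

Definition Des (n : nat) (R : pred nat) (S : seq (seq nat)) (w : seq nat) : seq nat :=
  [seq i <- iota 1 n.-1 | is_des R S w i].

Definition Comaj (n : nat) (R : pred nat) (S : seq (seq nat)) (w : seq nat) : nat :=
  \sum_(i <- Des n R S w) (n - i).

Definition Zstep (n : nat) (R : pred nat) (w : seq nat) (S : seq (seq nat)) :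
    seq (seq nat) :=
  [seq count (fun j => j < (index v w).+1) (Des n R S w) :: nth [::] S v.-1
  | v <- iota 1 n].

Fixpoint comajs_aux (n : nat) (R : pred nat) (Z : seq (seq nat)) (ws : seq (seq nat)) :
    seq nat :=
  match ws with
  | [::] => [::]
  | w :: ws' => Comaj n R Z w :: comajs_aux n R (Zstep n R w Z) ws'
  end.

Definition comaj_vec (n : nat) (R : pred nat) (ws : seq (seq nat)) : seq nat :=
  comajs_aux n R (nseq n [::]) (rcons ws (iota 1 n)).

Definition perm_word (n : nat) (s : 'S_n) : seq nat :=
  [seq (val (s i)).+1 | i <- enum 'I_n].

Definition syt_num_coef (n k : nat) (la : seq nat) (d : 'I_k -> nat) : nat :=
  #|[set p : {ffun cell n -> 'I_n.+1} * {ffun 'I_k.-1 -> 'S_n} |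
      is_SYT la p.1 &&
      [forall t : 'I_k,
         nth 0 (comaj_vec n (des_set la p.1)
                  [seq perm_word (p.2 j) | j <- enum 'I_k.-1]) t == d t]]|.

Definition syt_num_ps (n k : nat) (la : seq nat) : ps k :=
  fun d => Posz (syt_num_coef n la d).

(* Main.v *)
Require Import Defs.
From HB Require Import structures.
From mathcomp Require Import all_boot all_order all_algebra all_fingroup.
From mathcomp Require Import zify.
Set Implicit Arguments. Unset Strict Implicit. Unset Printing Implicit Defensive.
Import GRing.Theory.

(* Standardization turns a semistandard tableau F into a standard tableau T
   together with the weakly increasing list v^1, ..., v^n of its entries, which
   must increase strictly at the descents of T.  Fix T and put R = des(T).
   Whatever the columns x^1, ..., x^k of v are, the order on {1..n} that compares
   x^i first and breaks ties by the order of step i-1 is the order of positions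
   in a unique permutation pi^i; step 0 is the order a <_0 b iff a < b and not
   a ~_R b, or b < a and b ~_R a.  Comparing with Z^i or with the actual columns
   gives the same order, so Des_{R,Z^(i-1)}(pi^i) is exactly the set of places
   where x^i, read along pi^i, has to increase strictly, and subtracting the
   minimal such column leaves an arbitrary partition with at most n parts: this
   is q_i^comaj^i / (q_i;q_i)_n.  The list v is admissible iff pi^k = id.

   The recursion makes the last coordinate the most significant one, whereas the
   alphabet of the Schur function is ordered with the first coordinate most
   significant.  So one also needs that the number of semistandard tableaux of
   given content does not depend on the order of the alphabet, which is the
   Bender-Knuth symmetry. *)

(** * Strict total orders, ranks and sorting permutations *)

Lemma card_bij_in (T U : finType) (A : {pred T}) (B : {pred U})
    (f : T -> U) (g : U -> T) :
  (forall x, x \in A -> f x \in B /\ g (f x) = x) ->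
  (forall y, y \in B -> g y \in A /\ f (g y) = y) -> #|A| = #|B|.
Proof.
move=> fA gB; have injf : {in A &, injective f}.
  by move=> x y /fA[_ xK] /fA[_ yK] e; rewrite -xK e yK.
rewrite -(card_in_image injf); apply: eq_card => y.
apply/imageP/idP => [[x /fA[fx _] ->] // | /gB[gy e]].
by exists (g y).
Qed.

Definition strict_total (T : eqType) (r : rel T) : Prop :=
  [/\ irreflexive r, transitive r & forall x y, x != y -> r x y || r y x].

Definition lexr (T U : eqType) (lt : rel U) (f : T -> U) (r : rel T) : rel T :=
  fun a b => lt (f a) (f b) || (f a == f b) && r a b.

Lemma strict_total_ltn : strict_total ltn.
Proof.
split; [exact: ltnn | exact: ltn_trans | by move=> x y; rewrite neq_ltn].
Qed.

Lemma strict_total_asym (T : eqType) (r : rel T) x y :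
  strict_total r -> r x y -> r y x = false.
Proof.
by case=> ri rt _ xy; apply/negP => yx; move: (rt _ _ _ xy yx); rewrite ri.
Qed.

Lemma strict_total_neg (T : eqType) (r : rel T) x y :
  strict_total r -> x != y -> ~~ r y x = r x y.
Proof.
move=> st xy; case yx: (r y x); first by rewrite (strict_total_asym st yx).
by case: st => _ _ /(_ _ _ xy); rewrite yx orbF => ->.
Qed.

Lemma strict_total_lexr (T U : eqType) (lt : rel U) (f : T -> U) (r : rel T) :
  strict_total lt -> strict_total r -> strict_total (lexr lt f r).
Proof.
move=> [li lt_tr ltot] [ri rt rtot]; split.
- by move=> x; rewrite /lexr li ri andbF.
- move=> y x z /orP[xy|/andP[/eqP exy xy]] /orP[yz|/andP[/eqP eyz yz]]; apply/orP.
  + by left; apply: lt_tr xy yz.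
  + by left; rewrite -eyz.
  + by left; rewrite exy.
  + by right; rewrite exy eyz eqxx (rt _ _ _ xy yz).
- move=> x y xy; rewrite /lexr; case: (eqVneq (f x) (f y)) => [->|ne].
    by rewrite li rtot.
  by case/orP: (ltot _ _ ne) => -> //; rewrite orbT.
Qed.

Lemma strict_total_inj (T U : eqType) (f : T -> U) (r : rel U) :
  injective f -> strict_total r -> strict_total (fun a b => r (f a) (f b)).
Proof.
move=> fI [ri rt rtot]; split=> [x|x y z|x y xy]; [exact: ri | exact: rt |].
by apply: rtot; rewrite (inj_eq fI).
Qed.

Lemma strict_total_rcongr (T : eqType) (r r' : rel T) :
  r =2 r' -> strict_total r -> strict_total r'.
Proof.
move=> e [ri rt rtot]; split=> [x|x y z|x y].
- by rewrite -e.
- by rewrite -!e; apply: rt.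
- by rewrite -!e; apply: rtot.
Qed.

(** Comparisons of neighbours propagate by transitivity, and asymmetry excludes the reverse
    direction. This is what later reduces sortedness and increase of rows to conditions on
    consecutive indices. *)
Lemma strict_total_adjacent n (r : rel 'I_n) : strict_total r ->
  (forall i j : 'I_n, j = i.+1 :> nat -> r i j) ->
  forall i j : 'I_n, r i j = (i < j).
Proof.
move=> st adj.
have lt_r (i j : 'I_n) : i < j -> r i j.
  case: j => j jn /=; elim: j jn => // j IH jn; rewrite ltnS leq_eqVlt.
  case/orP=> [/eqP ij|ij]; first by apply: adj => /=; rewrite ij.
  have jn' : j < n by lia.
  case: (st) => _ rt _; apply: rt (IH jn' ij) _; exact: adj.
move=> i j; case: (ltngtP i j) => [/lt_r -> //|/lt_r ji|/val_inj ->].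
  exact: strict_total_asym ji.
by case: st => ->.
Qed.

Lemma perm_in_iota (T : finType) (D : {pred T}) (f : T -> nat) :
  {in D &, injective f} -> {in D, forall x, f x < #|D|} ->
  perm_eq [seq f x | x in D] (iota 0 #|D|).
Proof.
move=> fI fD; have u : uniq [seq f x | x in D].
  by rewrite map_inj_in_uniq ?enum_uniq // => x y; rewrite !mem_enum; apply: fI.
apply: uniq_perm => //; first exact: iota_uniq.
have sub : {subset [seq f x | x in D] <= iota 0 #|D|}.
  by move=> i /imageP[x xD ->]; rewrite mem_iota /= fD.
by apply: (uniq_min_size u sub _).2; rewrite size_iota size_image.
Qed.

Lemma sum_in_bij (T : finType) (D : {pred T}) (f : T -> nat) (h : nat -> nat) :
  {in D &, injective f} -> {in D, forall x, f x < #|D|} ->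
  \sum_(x in D) h (f x) = \sum_(i < #|D|) h i.
Proof.
move=> fI fD; rewrite -(big_mkord xpredT h) /index_iota subn0.
rewrite -(perm_big _ (perm_in_iota fI fD)) /image_mem big_map.
by rewrite big_enum.
Qed.

Lemma sum_lt_ord n m : m <= n -> \sum_(i < n) (i < m) = m.
Proof.
move=> mn; transitivity (\sum_(i < m) 1); last by rewrite sum_nat_const card_ord muln1.
rewrite (big_ord_widen n (fun=> 1) mn) [RHS]big_mkcond /=.
by apply: eq_bigr => i _; case: (_ < _).
Qed.

Lemma card_ltn_ord n m : m <= n -> #|[pred i : 'I_n | i < m]| = m.
Proof.
move=> mn; rewrite -[RHS](sum_lt_ord mn) -sum1_card big_mkcond /=.
by apply: eq_bigr => i _; rewrite inE; case: (_ < _).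
Qed.

Lemma card_below (T : finType) (D : {pred T}) (f : T -> nat) m :
  {in D &, injective f} -> {in D, forall x, f x < #|D|} -> m <= #|D| ->
  #|[pred x in D | f x < m]| = m.
Proof.
move=> fI fD mD; rewrite -[RHS](sum_lt_ord mD).
rewrite -(sum_in_bij (fun i => (i < m) : nat) fI fD) -sum1_card big_mkcondr /=.
by apply: eq_bigr => x _; case: (_ < _).
Qed.

Definition rank (T : finType) (D : {pred T}) (r : rel T) (x : T) : nat :=
  #|[pred y in D | r y x]|.

Section Rank.
Variables (T : finType) (D : {pred T}) (r : rel T).
Hypothesis st : strict_total r.

Lemma rank_lt_card x : x \in D -> rank D r x < #|D|.
Proof.
move=> xD; apply: proper_card; apply/properP; split.
  by apply/subsetP => y /andP[].
by exists x => //; rewrite inE /= xD; case: st => ->.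
Qed.

Lemma rank_lt x y : x \in D -> r x y -> rank D r x < rank D r y.
Proof.
move=> xD xy; apply: proper_card; apply/properP; split.
  apply/subsetP => z; rewrite !inE => /andP[-> zx] /=.
  by case: st => _ tr _; apply: tr zx xy.
by exists x; rewrite inE /= xD //=; case: st => ->.
Qed.

Lemma rank_ltE : {in D &, forall x y, (rank D r x < rank D r y) = r x y}.
Proof.
move=> x y xD yD; apply/idP/idP => [|/(rank_lt xD)//].
case: (eqVneq x y) => [->|ne]; first by rewrite ltnn.
case: (st) => _ _ /(_ _ _ ne) /orP[//|/(rank_lt yD)].
by move=> ? ?; lia.
Qed.

Lemma rank_inj : {in D &, injective (rank D r)}.
Proof.
move=> x y xD yD e; apply/eqP/idPn => ne.
by case: (st) => _ _ /(_ _ _ ne); rewrite -!rank_ltE // e ltnn.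
Qed.

(** An injective [f] with values below [#|D|] takes every such value once, so [f x] counts the
    elements with smaller value; by monotonicity these are the [r]-predecessors of [x]. *)
Lemma rank_unique (f : T -> nat) :
  {in D &, injective f} -> {in D, forall x, f x < #|D|} ->
  {in D &, forall x y, f x < f y -> r x y} ->
  {in D, forall x, f x = rank D r x}.
Proof.
move=> fI fD fr x xD; rewrite -[LHS](card_below fI fD); last exact/ltnW/fD.
apply: eq_card => y; rewrite !inE; case yD: (y \in D) => //=.
apply/idP/idP => [/(fr _ _ yD xD)//|yx].
case: (ltngtP (f y) (f x)) => [//|/(fr _ _ xD yD) xy|/(fI _ _ yD xD) exy].
  by rewrite (strict_total_asym st xy) in yx.
by move: yx; rewrite exy; case: (st) => ->.
Qed.

End Rank.

Section PermOrder.
Variable n : nat.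
Implicit Types (p q : 'S_n) (r : rel 'I_n) (x : 'I_n -> nat).
Local Open Scope group_scope.

(** [p^-1 a] is the position of the letter [a] in the one-line word of [p], so this is the order of
    appearance. *)
Definition ord p : rel 'I_n := fun a b => (p^-1 a < p^-1 b)%N.

Definition sorts r x p : bool :=
  [forall a, forall b, ord p a b == lexr ltn x r a b].

Lemma sortsP r x p : reflect (ord p =2 lexr ltn x r) (sorts r x p).
Proof.
apply: (iffP forallP) => [H a b|H a].
  by move/forallP: (H a) => /(_ b)/eqP.
by apply/forallP => b; apply/eqP/H.
Qed.

Lemma strict_total_ord p : strict_total (ord p).
Proof.
apply: (strict_total_inj (f := fun a => val (p^-1 a)) _ strict_total_ltn).
by move=> a b /val_inj/perm_inj.
Qed.

Lemma ord_perm_inj p q : ord p =2 ord q -> p = q.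
Proof.
move=> e; apply: invg_inj; apply/permP => a; apply: val_inj.
have H (s : 'S_n) : val (s^-1 a) = rank predT (ord s) a.
  apply: (rank_unique (strict_total_ord s) (f := fun a => val (s^-1 a))) => //.
  - by move=> b c _ _ /val_inj/perm_inj.
  - by move=> b _; rewrite card_ord ltn_ord.
by rewrite !H; apply: eq_card => b; rewrite !inE e.
Qed.

Lemma sorts_unique r x p q : sorts r x p -> sorts r x q -> p = q.
Proof. by move=> /sortsP ep /sortsP eq; apply: ord_perm_inj => a b; rewrite ep eq. Qed.

Lemma sorts_ex r x : strict_total r -> exists p, sorts r x p.
Proof.
move=> st; have stl := strict_total_lexr x strict_total_ltn st.
pose rk a : nat := rank predT (lexr ltn x r) a.
have rkn a : (rk a < n)%N by have := rank_lt_card stl (x := a) (D := predT) isT; rewrite card_ord.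
have rkI : injective (fun a => Ordinal (rkn a)).
  by move=> a b [] /(rank_inj stl) -> //.
(* The rank of a letter is its position, so the rank map is the inverse of the permutation
   sought. *)
exists (perm rkI)^-1; apply/sortsP => a b.
by rewrite /ord invgK !permE /= /rk (rank_ltE stl).
Qed.

(** Only consecutive positions matter, and there [x] must increase strictly exactly when [r] puts
    the two letters in reverse order; the boolean is added as the required 0 or 1. *)
Lemma sortsE r x p : strict_total r ->
  sorts r x p = [forall i : 'I_n, forall j : 'I_n, (j == i.+1 :> nat) ==>
     (x (p i) + r (p j) (p i) <= x (p j))%N].
Proof.
move=> st; have stl := strict_total_lexr x strict_total_ltn st.
have adj (i j : 'I_n) : j = i.+1 :> nat ->
    lexr ltn x r (p i) (p j) = (x (p i) + r (p j) (p i) <= x (p j))%N.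
  move=> ij; rewrite /lexr /=; rewrite -(strict_total_neg st); last first.
    by rewrite (inj_eq perm_inj); apply/eqP => eij; rewrite eij in ij; lia.
  by case: (r _ _); rewrite ?andbF ?andbT ?orbF ?addn1 ?addn0 /=; lia.
apply/sortsP/forallP => [H i|H a b].
  apply/forallP => j; apply/implyP => /eqP ij.
  by rewrite -adj // -H /ord !permK ij.
have stp := strict_total_inj (@perm_inj _ p) stl.
have := strict_total_adjacent stp _ (p^-1 a) (p^-1 b).
rewrite !permKV /ord => -> // i j ij.
by rewrite adj //; move: (H i) => /forallP/(_ j); rewrite ij eqxx.
Qed.

End PermOrder.

(** * Columns sorted by a fixed permutation *)

Section PrefixSums.
Variables (n : nat) (h : 'I_n -> nat).

Lemma prefix_sum0 (j : 'I_n) : j = 0 :> nat -> \sum_(i < n | i <= j) h i = h j.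
Proof.
move=> j0; rewrite (big_pred1 j) // => i /=.
by rewrite j0 leqn0 -j0.
Qed.

Lemma prefix_sumS (i j : 'I_n) : j = i.+1 :> nat ->
  \sum_(l < n | l <= j) h l = \sum_(l < n | l <= i) h l + h j.
Proof.
move=> ij; rewrite (bigD1 j) //= addnC; congr (_ + _); apply: eq_bigl => l.
by rewrite -val_eqE /= ij; lia.
Qed.

(** After exchanging the sums, [h j] is counted once for each index at or after [j]. This is the
    source of the weight [n - j] in the comaj statistic. *)
Lemma sum_prefix_sum :
  \sum_(i < n) \sum_(j < n | j <= i) h j = \sum_(j < n) (n - j) * h j.
Proof.
rewrite (exchange_big_dep xpredT) //=; apply: eq_bigr => j _.
rewrite sum_nat_const; congr (_ * _).
have e := cardC [pred i : 'I_n | i < j]; rewrite card_ord in e.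
have j_lt := card_ltn_ord (ltnW (ltn_ord j)).
have -> : #|[pred i : 'I_n | j <= i]| = #|[predC [pred i : 'I_n | i < j]]|.
  by apply: eq_card => i; rewrite !inE -leqNgt.
rewrite j_lt in e; apply: (@addnI j); rewrite subnKC ?(ltnW (ltn_ord j)) //; exact: e.
Qed.

End PrefixSums.

Section Descents.
Variables (n : nat) (r : rel 'I_n) (p : 'S_n).
Hypothesis st : strict_total r.
Local Open Scope group_scope.

(** A descent is indexed by the second of its two 0-based positions. This number equals the usual
    1-based index of the descent, so its weight is [n - j], and 0 is never a descent. *)
Definition descent_at (j : 'I_n) : bool :=
  [exists i : 'I_n, (j == i.+1 :> nat) && r (p j) (p i)].

Definition comaj : nat := (\sum_(j < n) (n - j) * descent_at j)%N.

(* The column prepended by Zstep, for 0-based values; it is the smallest column sorted by p. *)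
Definition zcol (a : 'I_n) : nat := (\sum_(j < n | (j <= p^-1 a)%N) descent_at j)%N.

Lemma descent_at_succ (i j : 'I_n) : j = i.+1 :> nat -> descent_at j = r (p j) (p i).
Proof.
move=> ij; apply/existsP/idP => [[i' /andP[/eqP ij']]|rji].
  by rewrite (_ : i' = i) //; apply/val_inj/succn_inj; rewrite -ij' -ij.
by exists i; rewrite ij eqxx.
Qed.

Lemma descent_at0 (j : 'I_n) : j = 0%N :> nat -> descent_at j = false.
Proof. by move=> j0; apply/existsP => -[i]; rewrite j0. Qed.

Lemma sorts_descentP (x : 'I_n -> nat) :
  reflect (forall i j : 'I_n, j = i.+1 :> nat -> (x (p i) + descent_at j <= x (p j))%N)
          (sorts r x p).
Proof.
rewrite sortsE //; apply: (iffP forallP) => [H i j ij|H i].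
  by rewrite (descent_at_succ ij); move/forallP: (H i) => /(_ j); rewrite ij eqxx.
by apply/forallP => j; apply/implyP => /eqP ij; rewrite -(descent_at_succ ij) H.
Qed.

Lemma sorts_zcol : sorts r zcol p.
Proof.
by apply/sorts_descentP => i j ij; rewrite /zcol !permK (prefix_sumS _ ij).
Qed.

(** The entry at the position before [j]: the sum has at most one term, and being empty at [j = 0]
    it supplies the initial value 0. *)
Definition prevs (x : 'I_n -> nat) (j : 'I_n) : nat :=
  (\sum_(i < n | j == i.+1 :> nat) x (p i))%N.

Lemma prevs_succ x (i j : 'I_n) : j = i.+1 :> nat -> prevs x j = x (p i).
Proof.
move=> ij; rewrite /prevs (big_pred1 i) // => l /=.
by rewrite ij eqSS eq_sym.
Qed.

Lemma prevs0 x (j : 'I_n) : j = 0%N :> nat -> prevs x j = 0%N.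
Proof. by move=> j0; rewrite /prevs big_pred0 // => l; rewrite j0. Qed.

(** A sorted column is the sequence of partial sums of its increments. Each increment is written as
    its free part plus the part forced by a descent, and sortedness makes the truncated subtractions
    exact. *)
Lemma prefix_sum_diff (x : 'I_n -> nat) : sorts r x p -> forall j : 'I_n,
  (\sum_(i < n | (i <= j)%N) (x (p i) - prevs x i - descent_at i + descent_at i) = x (p j))%N.
Proof.
move=> /sorts_descentP sx [j]; elim: j => [|j IH] jn.
  by rewrite prefix_sum0 // prevs0 // descent_at0 // subn0 subn0 addn0.
have jn' : (j < n)%N by lia.
rewrite (@prefix_sumS _ _ (Ordinal jn')) // IH.
rewrite (prevs_succ x (i := Ordinal jn')) //.
by have := sx (Ordinal jn') (Ordinal jn) erefl; lia.
Qed.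

Lemma sum_prefix_perm (h : 'I_n -> nat) :
  (\sum_a \sum_(j < n | (j <= p^-1 a)%N) h j = \sum_(j < n) (n - j) * h j)%N.
Proof.
rewrite (reindex_inj (@perm_inj _ p)) /= -sum_prefix_sum.
by apply: eq_bigr => i _; apply: eq_bigl => j; rewrite permK.
Qed.

(** The bijection sends [x] to its increments along [p], less the forced 1 at each descent;
    conversely the descents are added back and partial sums taken. An increment at [j] raises
    [n - j] entries, whence the weighted total plus [comaj]. The bounds [M] and [N] lose nothing, as
    no entry or increment exceeds the total [m]. *)
Lemma card_sorted_columns (M N m : nat) : (m <= M)%N -> (m <= N)%N ->
  #|[set x : {ffun 'I_n -> 'I_M.+1} | sorts r (fun a => x a) p & (\sum_a x a == m)%N]| =
  #|[set u : {ffun 'I_n -> 'I_N.+1} | (\sum_(j < n) (n - j) * u j + comaj == m)%N]|.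
Proof.
move=> mM mN.
pose f (x : {ffun 'I_n -> 'I_M.+1}) : {ffun 'I_n -> 'I_N.+1} :=
  [ffun j => inord (x (p j) - prevs (fun a => x a) j - descent_at j)].
pose g (u : {ffun 'I_n -> 'I_N.+1}) : {ffun 'I_n -> 'I_M.+1} :=
  [ffun a => inord (\sum_(j < n | (j <= p^-1 a)%N) (u j + descent_at j))].
have total (h : 'I_n -> nat) : (\sum_a \sum_(j < n | (j <= p^-1 a)%N) (h j + descent_at j) =
    \sum_(j < n) (n - j) * h j + comaj)%N.
  by rewrite sum_prefix_perm -big_split /=; apply: eq_bigr => j _; rewrite mulnDr.
apply: (card_bij_in (f := f) (g := g)) => [x|u]; rewrite !inE.
- case/andP => sx /eqP sumx.
  have xm a : (x a <= m)%N by rewrite -sumx (bigD1 a) //= leq_addr.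
  have fE j : f x j = (x (p j) - prevs (fun a => x a) j - descent_at j)%N :> nat.
    rewrite ffunE inordK // ltnS; apply: leq_trans mN; apply: leq_trans (xm (p j)).
    exact: leq_trans (leq_subr _ _) (leq_subr _ _).
  have gfE a : (\sum_(j < n | (j <= p^-1 a)%N) (f x j + descent_at j))%N = x a.
    rewrite -[in RHS](permKV p a) -(prefix_sum_diff sx).
    by apply: eq_bigr => j _; rewrite fE.
  split; last by apply/ffunP => a; rewrite ffunE gfE inord_val.
  by rewrite -total -sumx; apply/eqP/eq_bigr => a _; rewrite gfE.
- move/eqP => sumu.
  have gm a : (\sum_(j < n | (j <= p^-1 a)%N) (u j + descent_at j) <= m)%N.
    by rewrite -sumu -total [X in (_ <= X)%N](bigD1 a) //= leq_addr.
  have gE a : g u a = (\sum_(j < n | (j <= p^-1 a)%N) (u j + descent_at j))%N :> nat.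
    by rewrite ffunE inordK // ltnS (leq_trans (gm a)).
  split.
    apply/andP; split; last first.
      by rewrite -sumu -total; apply/eqP/eq_bigr => a _; rewrite gE.
    by apply/sorts_descentP => i j ij; rewrite !gE !permK (prefix_sumS _ ij); lia.
  apply/ffunP => j; rewrite ffunE; apply: val_inj.
  have -> : (g u (p j) - prevs (fun a => g u a) j - descent_at j)%N = u j.
    case: j => -[|j] jn.
      by rewrite prevs0 // descent_at0 // gE permK prefix_sum0 // descent_at0 // !subn0 addn0.
    have jn' : (j < n)%N by lia.
    rewrite (prevs_succ _ (i := Ordinal jn')) // !gE !permK.
    by rewrite (@prefix_sumS _ _ (Ordinal jn')) //; lia.
  by rewrite inord_val.
Qed.

End Descents.

(** * Generating function of the columns sorted by a fixed permutation *)

Section GeneratingFunction.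
Local Open Scope ring_scope.

(** All exponents in the product are at least [N], so it is 1 modulo ['X^N] and does not affect the
    coefficient at [d < N]. *)
Lemma prod_1subX_coef n N (c d : nat) : (d < N)%N ->
  ('X^c * \prod_(j < n) (1 - 'X^((n - j) * N)) : {poly int})`_d = (d == c)%:R.
Proof.
move=> dN; have [Q ->] : exists Q : {poly int},
    \prod_(j < n) (1 - 'X^((n - j) * N)) = 1 + 'X^N * Q.
  elim/big_rec: _ => [|j y _ [Q ->]]; first by exists 0; rewrite mulr0 addr0.
  have -> : ((n - j) * N = N + (n - j).-1 * N)%N.
    by rewrite -mulSn prednK // subn_gt0.
  rewrite exprD; exists (Q - 'X^((n - j).-1 * N) * (1 + 'X^N * Q)).
  by rewrite mulrBl mul1r mulrBr -addrA !mulrA.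
rewrite mulrDr mulr1 coefD coefXn mulrCA coefXnM dN addr0 //.
Qed.

Lemma qpoch_revE n : qpoch n = \prod_(j < n) (1 - 'X^(n - j)).
Proof.
rewrite /qpoch (reindex_inj rev_ord_inj) /=; apply: eq_bigr => j _.
by rewrite subnSK.
Qed.

Lemma card_weighted_coef n N c m :
  (#|[set u : {ffun 'I_n -> 'I_N} | (\sum_(j < n) (n - j) * u j + c == m)%N]|)%:R =
  ('X^c * \prod_(j < n) \sum_(u < N) 'X^((n - j) * u) : {poly int})`_m.
Proof.
rewrite bigA_distr_bigA mulr_sumr coef_sum -sum1_card natr_sum big_mkcond /=.
apply: eq_bigr => u _; rewrite -(big_morph _ (exprD 'X) (expr0 'X)) -exprD coefXn.
by rewrite inE addnC eq_sym; case: (_ == _).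
Qed.

(** The columns sorted by [p] have generating function ['X^(comaj r p)] divided by [qpoch n], so
    multiplying by [qpoch n] leaves one monomial. The sum is the convolution in the form in which
    [ps_mul] presents it, with a bound [D] common to all variables. *)
Lemma card_sorted_columns_qpoch n (r : rel 'I_n) (p : 'S_n) D d :
  strict_total r -> (d <= D)%N ->
  \sum_(m < D.+1 | (m <= d)%N)
    #|[set x : {ffun 'I_n -> 'I_m.+1} | sorts r (fun a => x a) p & (\sum_a x a == m)%N]|%:R
      * (qpoch n)`_(d - m) = (d == comaj r p)%:R.
Proof.
move=> st dD.
transitivity (\sum_(m < d.+1)
   ('X^(comaj r p) * \prod_(j < n) \sum_(u < d.+1) 'X^((n - j) * u) : {poly int})`_m
     * (qpoch n)`_(d - m)).
  set P := 'X^_ * _; rewrite (big_ord_widen D.+1 (fun m => P`_m * (qpoch n)`_(d - m))) ?ltnS //.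
  apply: eq_bigr => m md; rewrite -card_weighted_coef.
  by rewrite (@card_sorted_columns _ _ _ st m d m).
rewrite -coefM -mulrA qpoch_revE -big_split /=.
(* The geometric series were truncated after degree index [d], so each factor telescopes to
   [1 - 'X^((n - j) * d.+1)]. *)
rewrite -(@prod_1subX_coef n d.+1) //; congr ((_ * _ : {poly int})`_d).
apply: eq_bigr => j _; rewrite exprM -[in RHS](expr1n _ d.+1) subrXX mulrC.
by congr (_ * _); apply: eq_bigr => i _; rewrite expr1n mul1r exprM.
Qed.

End GeneratingFunction.

(** * The orders attached to Z and to a list of columns *)

Section TieBreak.
Variable R : pred nat.

(** The order on letters whose reversals along a word are the descents: [is_des] at [i] says that
    the letter at [i] precedes the one before it. *)
Definition tie_lt (S : seq (seq nat)) (a b : nat) : bool :=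
  let sa := nth [::] S a.-1 in let sb := nth [::] S b.-1 in
  lex_lt sa sb ||
  ((sa == sb) && (((a < b) && ~~ simR R a b) || ((b < a) && simR R b a))).

Lemma is_des_tie_lt S w i : is_des R S w i = tie_lt S (nth 0 w i) (nth 0 w i.-1).
Proof. by rewrite /is_des /tie_lt eq_sym. Qed.

Definition tie0 n : rel 'I_n := fun a b =>
  ((a < b) && ~~ simR R a.+1 b.+1) || ((b < a) && simR R b.+1 a.+1).

(* Number of blocks of the relation ~_R before the block of the 0-based element m. *)
Definition gaps (m : nat) : nat := count (predC R) (iota 1 m).

(** The numbers from [a + 1] to [b] all lie in [R] exactly when the count of numbers outside [R]
    does not grow between [a] and [b]. *)
Lemma simR_gaps (a b : nat) : a <= b -> simR R a.+1 b.+1 = (gaps a == gaps b).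
Proof.
move=> ab; rewrite /simR /gaps (minn_idPl _) // (maxn_idPr _) // subSS.
rewrite -{2}(subnKC ab) iotaD count_cat -{1}[count _ (iota 1 a)]addn0 eqn_add2l add1n.
by rewrite eq_sym -leqn0 leqNgt -has_count has_predC negbK.
Qed.

Lemma gaps_mono (a b : nat) : a <= b -> gaps a <= gaps b.
Proof. by move=> ab; rewrite /gaps -{1}(subnKC ab) iotaD count_cat leq_addr. Qed.

(** The blocks of the relation come in increasing order and each block is reversed. This presents
    [tie0] as a lexicographic order, hence as a strict total one. *)
Lemma tie0_gaps n :
  @tie0 n =2 lexr ltn (fun a : 'I_n => gaps a) (fun a b => b < a).
Proof.
move=> a b; rewrite /tie0 /lexr /=; case: (ltngtP a b) => ab /=.
- by rewrite simR_gaps ?(ltnW ab) // andbF !orbF neq_ltn; have := gaps_mono (ltnW ab); lia.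
- by rewrite simR_gaps ?(ltnW ab) // andbT eq_sym; have := gaps_mono (ltnW ab); lia.
- by rewrite ab ltnn andbF.
Qed.

Lemma strict_total_tie0 n : strict_total (@tie0 n).
Proof.
apply: strict_total_rcongr (fun a b => esym (@tie0_gaps n a b)) _.
apply: strict_total_lexr; first exact: strict_total_ltn.
split=> [x|x y z|x y]; rewrite ?ltnn //; first by move=> xy zx; apply: ltn_trans zx xy.
by rewrite neq_ltn orbC.
Qed.

Lemma tie_lt_nil n (a b : 'I_n) : tie_lt (nseq n [::]) a.+1 b.+1 = tie0 a b.
Proof. by rewrite /tie_lt /tie0 !nth_nseq !ltn_ord /= !ltnS. Qed.

Section Step.
Variables (n : nat) (Z : seq (seq nat)) (r : rel 'I_n) (p : 'S_n).
Hypothesis st : strict_total r.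
Hypothesis rZ : forall a b : 'I_n, tie_lt Z a.+1 b.+1 = r a b.

Lemma nth_perm_word (i : 'I_n) : nth 0 (perm_word p) i = (p i).+1.
Proof. by rewrite (nth_map i) ?size_enum_ord // nth_ord_enum. Qed.

Lemma index_perm_word (a : 'I_n) : index a.+1 (perm_word p) = (p^-1)%g a.
Proof.
rewrite -{1}(permKV p a) /perm_word (index_map (f := fun i => (val (p i)).+1)).
  exact: index_enum_ord.
by move=> i j [] /val_inj /perm_inj.
Qed.

Lemma sum_Des (F : nat -> nat) :
  \sum_(i <- Des n R Z (perm_word p)) F i = \sum_(j < n) F j * descent_at r p j.
Proof.
rewrite /Des big_filter.
pose d i := (0 < i) && is_des R Z (perm_word p) i.
have dE (j : 'I_n) : descent_at r p j = d j.
  rewrite /d; case: j => -[|j] jn; first by rewrite descent_at0.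
  have jn' : j < n by lia.
  rewrite (descent_at_succ r p (i := Ordinal jn')) // is_des_tie_lt -rZ.
  by rewrite -!nth_perm_word.
rewrite (eq_bigr (fun j : 'I_n => F j * d j)) => [|j _]; last by rewrite dE.
rewrite -(big_mkord xpredT (fun j => F j * d j)) /d.
move: (is_des R Z (perm_word p)) => q; case: (n) => [|m]; first by rewrite big_nil big_geq.
(* Position 0 contributes nothing, so the sum can start at 1, as the list in [Des] does. *)
rewrite big_ltn // muln0 add0n /index_iota subSS subn0 big_mkcond /=.
rewrite big_seq [RHS]big_seq; apply: eq_bigr => i.
by rewrite mem_iota => /andP[-> _] /=; case: (q i); rewrite ?muln1 ?muln0.
Qed.

Lemma ComajE : Comaj n R Z (perm_word p) = comaj r p.
Proof. by rewrite /Comaj sum_Des. Qed.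

(** The prepended column is [zcol r p], which [p] sorts with ties broken by the order of [Z]. Hence
    the order of the new list is the order of positions in [p], and all other information in [Z] can
    be forgotten. *)
Lemma tie_lt_Zstep (a b : 'I_n) :
  tie_lt (Zstep n R (perm_word p) Z) a.+1 b.+1 = ord p a b.
Proof.
have zE (c : 'I_n) : nth [::] (Zstep n R (perm_word p) Z) c =
    zcol r p c :: nth [::] Z c.
  rewrite /Zstep (nth_map 0) ?size_iota // nth_iota // add1n; congr (_ :: _).
  rewrite index_perm_word -sum1_count big_mkcond /= sum_Des /zcol.
  rewrite [RHS]big_mkcond /=; apply: eq_bigr => j _.
  by rewrite ltnS; case: (_ <= _); rewrite ?mul1n.
move/sortsP: (sorts_zcol p st) => ->; rewrite /tie_lt /= !zE /= /lexr /= -rZ /tie_lt /=.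
by rewrite eqseq_cons; case: (ltngtP (zcol r p a) (zcol r p b)).
Qed.

End Step.

(** By [tie_lt_Zstep], the recursion on [Z] remembers only the order of positions in the preceding
    permutation. *)
Lemma nth_comajs_aux n Z (r : rel 'I_n) (ps : seq 'S_n) t : strict_total r ->
  (forall a b : 'I_n, tie_lt Z a.+1 b.+1 = r a b) -> t < size ps ->
  nth 0 (comajs_aux n R Z [seq perm_word p | p <- ps]) t =
  comaj (nth r (r :: [seq ord p | p <- ps]) t) (nth 1%g ps t).
Proof.
elim: ps Z r t => [//|p ps IH] Z r [|t] st rZ tn /=; first exact: ComajE.
rewrite (IH _ (ord p)) //; last 2 first.
- exact: strict_total_ord.
- by move=> a b; apply: (tie_lt_Zstep p st rZ).
congr (comaj _ _); apply: set_nth_default; rewrite /= size_map; exact: leqW.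
Qed.

End TieBreak.

Lemma perm_word1 n : perm_word (1 : 'S_n)%g = iota 1 n.
Proof.
rewrite /perm_word (eq_map (g := S \o val)) => [|i]; last by rewrite /= perm1.
by rewrite map_comp val_enum_ord -(iotaDl 1 0).
Qed.

(** * Lists of columns and the permutations they force *)

Section Columns.
Variables (n k : nat) (R : pred nat).
Implicit Types (s : {ffun 'I_k -> 'S_n}) (X : nat -> 'I_n -> nat).

(** From here on there are [k.+1] variables and [k] free permutations; the appended identity is the
    prescribed last permutation. *)
Definition words s : seq 'S_n := rcons [seq s j | j <- enum 'I_k] 1%g.
Definition perm_at s (t : nat) : 'S_n := nth 1%g (words s) t.
(* The order that breaks ties at step t: that of <_0 for t = 0, and the positions
   in pi^t (that is, perm_at s t.-1) afterwards. *)
Definition prior_ord s (t : nat) : rel 'I_n :=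
  nth (@tie0 R n) (@tie0 R n :: [seq ord p | p <- words s]) t.

Lemma size_words s : size (words s) = k.+1.
Proof. by rewrite size_rcons size_map size_enum_ord. Qed.

Lemma perm_at_ord s (t : 'I_k) : perm_at s t = s t.
Proof.
rewrite /perm_at nth_rcons size_map size_enum_ord ltn_ord.
by rewrite (nth_map t) ?size_enum_ord // nth_ord_enum.
Qed.

Lemma perm_at_last s : perm_at s k = 1%g.
Proof. by rewrite /perm_at nth_rcons size_map size_enum_ord ltnn eqxx. Qed.

Lemma prevS s t : t < k.+1 -> prior_ord s t.+1 = ord (perm_at s t).
Proof. by move=> tk; rewrite /prior_ord /= (nth_map 1%g) // size_words. Qed.

Lemma strict_total_prior_ord s t : t < k.+1 -> strict_total (prior_ord s t).
Proof.
case: t => [_|t tk]; first exact: strict_total_tie0.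
by rewrite prevS 1?ltnW //; apply: strict_total_ord.
Qed.

Lemma comaj_vecE s (t : 'I_k.+1) :
  nth 0 (comaj_vec n R [seq perm_word (s j) | j <- enum 'I_k]) t =
  comaj (prior_ord s t) (perm_at s t).
Proof.
rewrite /comaj_vec -perm_word1 (map_comp (@perm_word n) s) -map_rcons.
rewrite (nth_comajs_aux (r := @tie0 R n)) ?size_words //.
- exact: strict_total_tie0.
- by move=> a b; rewrite tie_lt_nil.
Qed.

Fixpoint iter_lex X m : rel 'I_n :=
  if m is m'.+1 then lexr ltn (X m') (iter_lex X m') else @tie0 R n.

Lemma strict_total_iter_lex X m : strict_total (iter_lex X m).
Proof.
elim: m => [|m IH] /=; first exact: strict_total_tie0.
exact: strict_total_lexr strict_total_ltn IH.
Qed.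

Lemma sorts_congr (r r' : rel 'I_n) x p : r =2 r' -> sorts r x p = sorts r' x p.
Proof.
move=> e; apply/sortsP/sortsP => H a b; rewrite H /lexr e //.
Qed.

(** The permutation that the columns alone force at step [t]. The default is never taken, since a
    sorting permutation exists. *)
Definition rho X t : 'S_n := odflt 1%g [pick p | sorts (iter_lex X t) (X t) p].

Lemma sorts_rho X t : sorts (iter_lex X t) (X t) (rho X t).
Proof.
rewrite /rho; case: pickP => //= H.
by case: (sorts_ex (X t) (strict_total_iter_lex X t)) => p; rewrite H.
Qed.

Lemma ord_rho X t : ord (rho X t) =2 iter_lex X t.+1.
Proof. exact/sortsP/sorts_rho. Qed.

(** The order [prior_ord s t] depends on the permutations and [iter_lex X t] on the columns. As soon
    as all permutations before [t] agree with [rho X], the two orders coincide, and uniqueness of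
    the sorting permutation carries the induction to [t]. *)
Lemma all_sortsE s X :
  [forall t : 'I_k.+1, sorts (prior_ord s t) (X t) (perm_at s t)] =
  [forall t : 'I_k.+1, perm_at s t == rho X t].
Proof.
have prevE t : t < k.+1 -> (forall u, u < t -> perm_at s u = rho X u) ->
    prior_ord s t =2 iter_lex X t.
  case: t => [//|t] tk H a b; rewrite prevS 1?ltnW // H //; exact: ord_rho.
apply/forallP/forallP => H t.
  have : forall u : nat, u < k.+1 -> perm_at s u = rho X u.
    elim/ltn_ind => u IH uk.
    have e : prior_ord s u =2 iter_lex X u.
      by apply: prevE => // v vu; apply: IH => //; apply: ltn_trans vu uk.
    apply: (sorts_unique (r := iter_lex X u) (x := X u)); last exact: sorts_rho.
    by rewrite -(sorts_congr _ _ e); apply: (H (Ordinal uk)).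
  by move=> ->.
rewrite (sorts_congr _ _ (prevE t (ltn_ord t) _)); last first.
  move=> u ut; have uk : u < k.+1 by apply: ltn_trans ut _.
  exact/eqP/(H (Ordinal uk)).
by rewrite (eqP (H t)); apply: sorts_rho.
Qed.

Definition increasing X : bool :=
  [forall i : 'I_n, forall j : 'I_n, (j == i.+1 :> nat) ==> iter_lex X k.+1 i j].

(** [rho X k] lists the indices in the order [iter_lex X k.+1]; it is the identity when this is the
    natural order, which can be tested on neighbours. *)
Lemma rho_lastE X : (rho X k == 1%g) = increasing X.
Proof.
have ord1 (i j : 'I_n) : ord 1%g i j = (i < j) by rewrite /ord invg1 !perm1.
apply/eqP/forallP => [e i|H].
  by apply/forallP => j; apply/implyP => /eqP ij; rewrite -ord_rho e ord1 ij.
apply: ord_perm_inj => i j; rewrite ord_rho ord1.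
apply: strict_total_adjacent; first exact: strict_total_iter_lex.
by move=> i' j' ij; move/forallP: (H i') => /(_ j'); rewrite ij eqxx.
Qed.

(** The columns determine [s] completely; the one remaining condition is that the last forced
    permutation be the identity. *)
Lemma card_words_sorting X :
  #|[set s | [forall t : 'I_k.+1, sorts (prior_ord s t) (X t) (perm_at s t)]]| = increasing X.
Proof.
rewrite -rho_lastE.
have -> : [set s | [forall t : 'I_k.+1, sorts (prior_ord s t) (X t) (perm_at s t)]] =
   [set s | (s == [ffun j : 'I_k => rho X j]) && (rho X k == 1%g)].
  apply/setP => s; rewrite !inE all_sortsE; apply/forallP/andP => [H|[/eqP -> /eqP e] t].
    split; last by rewrite -(perm_at_last s) eq_sym; apply: (H ord_max).
    apply/eqP/ffunP => j; rewrite ffunE -perm_at_ord.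
    exact/eqP/(H (widen_ord (leqnSn k) j)).
  case: (ltngtP t k) => tk.
  - by rewrite (perm_at_ord _ (Ordinal tk)) ffunE.
  - by have := ltn_ord t; lia.
  - by rewrite tk perm_at_last e.
case: eqP => _; last first.
  by rewrite (_ : [set _ | _] = set0) ?cards0 //; apply/setP => s; rewrite !inE andbF.
rewrite (_ : [set _ | _] = [set [ffun j : 'I_k => rho X j]]) ?cards1 //.
by apply/setP => s; rewrite !inE andbT.
Qed.

(** Double counting of the pairs of a list of columns and a compatible [s]: an increasing list has
    exactly one such [s], any other list none. For fixed [s] the columns are chosen independently,
    whence the product. *)
Lemma card_increasing_columns D (e : 'I_k.+1 -> nat) :
  #|[set X : {ffun 'I_k.+1 -> {ffun 'I_n -> 'I_D}} |
      increasing (fun t a => X (inord t) a) & [forall t, \sum_a X t a == e t]]| =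
  \sum_s \prod_(t < k.+1) #|[set x : {ffun 'I_n -> 'I_D} |
      sorts (prior_ord s t) (fun a => x a) (perm_at s t) & \sum_a x a == e t]|.
Proof.
under eq_bigr => s _ do under eq_bigr => t _ do rewrite -sum1_card.
under eq_bigr => s _ do rewrite (bigA_distr_big_dep (fun t x => x \in _) (fun _ _ => 1)) /=.
rewrite (exchange_big_dep xpredT) //= -sum1_card big_mkcond /=; apply: eq_bigr => X _.
rewrite inE.
rewrite (eq_bigr (fun=> 1)) => [|s _]; last by rewrite big1.
rewrite sum1_card.
case: (boolP [forall t, _]) => sumX; last first.
  rewrite andbF; symmetry; apply: eq_card0 => s; rewrite unfold_in; apply/negP => /familyP H.
  by case/negP: sumX; apply/forallP => t; have := H t; rewrite unfold_in inE => /andP[].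
rewrite andbT; transitivity (increasing (fun t a => X (inord t) a) : nat).
  by case: increasing.
rewrite -card_words_sorting; apply: eq_card => s; rewrite inE unfold_in.
apply/forallP/familyP => H t; have := H t.
  by rewrite unfold_in inE inord_val => ->; move/forallP: sumX => /(_ t).
by rewrite unfold_in inE inord_val => /andP[].
Qed.

End Columns.

Definition colex_lt k D (u v : {ffun 'I_k -> 'I_D}) : bool :=
  lex_lt (rev (entry_seq u)) (rev (entry_seq v)).

Lemma iter_lexE n R (X : nat -> 'I_n -> nat) m a b :
  let row c := rev [seq X t c | t <- iota 0 m] in
  iter_lex R X m a b = lex_lt (row a) (row b) || (row a == row b) && tie0 R a b.
Proof.
have rowS l c : rev [seq X t c | t <- iota 0 l.+1] = X l c :: rev [seq X t c | t <- iota 0 l].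
  by rewrite -addn1 iotaD map_cat rev_cat.
elim: m => [//|m IH] row; rewrite /row !rowS /= /lexr IH eqseq_cons /=.
by case: (ltngtP (X m a) (X m b)).
Qed.

Lemma entry_seq_inj k D : injective (@entry_seq k D).
Proof.
move=> u v e; apply/ffunP => t; apply: val_inj.
have nthE (w : {ffun 'I_k -> 'I_D}) : nth 0 (entry_seq w) t = w t.
  by rewrite (nth_map t) ?size_enum_ord // nth_ord_enum.
by rewrite -[LHS]nthE -[RHS]nthE e.
Qed.

Definition increasing_rows n k D (R : pred nat)
    (v : {ffun 'I_n -> {ffun 'I_k -> 'I_D}}) : bool :=
  [forall i : 'I_n, forall j : 'I_n, (j == i.+1 :> nat) ==>
     (colex_lt (v i) (v j) || (v i == v j) && ~~ R j)].

Lemma increasing_rowsE n k D R (X : {ffun 'I_k.+1 -> {ffun 'I_n -> 'I_D}}) :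
  increasing k R (fun t a => X (inord t) a) =
  increasing_rows R [ffun a => [ffun t => X t a]].
Proof.
apply: eq_forallb => i; apply: eq_forallb => j; case: eqP => //= ij.
rewrite -[lexr _ _ _ _ _]/(iter_lex _ _ k.+1 _ _) iter_lexE.
have rowE c : [seq (X (inord t) c : nat) | t <- iota 0 k.+1] =
    entry_seq ([ffun a => [ffun t => X t a]] c : {ffun 'I_k.+1 -> 'I_D}).
  rewrite -val_enum_ord -map_comp.
  by apply: eq_map => t; rewrite /= inord_val !ffunE.
rewrite !rowE (inj_eq (can_inj (@revK _))) (inj_eq (@entry_seq_inj _ _)) /colex_lt.
(* The 0-based neighbours [i] and [j = i + 1] are the letters [j] and [j + 1]; they lie in one
   block, and are then reversed, iff [j] is in [R]. *)
have -> // : tie0 R i j = ~~ R j.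
rewrite /tie0 /simR ij ltnS leqnn ltnNge leqnSn /= orbF /minn /maxn ltnS leqnn.
by rewrite subSn // subnn /= andbT.
Qed.

Lemma card_increasing_rows n k D R (e : 'I_k.+1 -> nat) :
  #|[set v : {ffun 'I_n -> {ffun 'I_k.+1 -> 'I_D}} |
      increasing_rows R v & [forall t, \sum_a v a t == e t]]| =
  \sum_(s : {ffun 'I_k -> 'S_n}) \prod_(t < k.+1) #|[set x : {ffun 'I_n -> 'I_D} |
      sorts (prior_ord R s t) (fun a => x a) (perm_at s t) & \sum_a x a == e t]|.
Proof.
rewrite -card_increasing_columns.
pose f (v : {ffun 'I_n -> {ffun 'I_k.+1 -> 'I_D}}) := [ffun t => [ffun a => v a t]].
pose g (X : {ffun 'I_k.+1 -> {ffun 'I_n -> 'I_D}}) := [ffun a => [ffun t => X t a]].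
apply: (card_bij_in (f := f) (g := g)) => v; rewrite !inE.
  have vK : g (f v) = v by apply/ffunP => a; apply/ffunP => t; rewrite !ffunE.
  case/andP=> incv /forallP H.
  rewrite increasing_rowsE -[X in increasing_rows R X]/(g (f v)) vK incv; split => //=.
  by apply/forallP => t; rewrite -(eqP (H t)); apply/eqP/eq_bigr => a _; rewrite !ffunE.
rewrite increasing_rowsE => /andP[-> /forallP H]; split.
  by apply/forallP => t; rewrite -(eqP (H t)); apply/eqP/eq_bigr => a _; rewrite !ffunE.
by apply/ffunP => a; apply/ffunP => t; rewrite !ffunE.
Qed.

(** * Standardization *)

Lemma lex_lt_irr s : lex_lt s s = false.
Proof. by elim: s => //= x s ->; rewrite ltnn andbF. Qed.

Lemma lex_lt_trans s t u : lex_lt s t -> lex_lt t u -> lex_lt s u.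
Proof.
elim: s t u => [|x s IH] [|y t] [|z u] //=.
move=> /orP[xy|/andP[/eqP -> st]] /orP[yz|/andP[/eqP <- tu]].
- by rewrite (ltn_trans xy yz).
- by rewrite xy.
- by rewrite yz.
- by rewrite eqxx (IH _ _ st tu) orbT.
Qed.

Lemma lex_lt_total s t : size s = size t -> s != t -> lex_lt s t || lex_lt t s.
Proof.
elim: s t => [|x s IH] [|y t] //= [e]; rewrite eqseq_cons.
by case: (ltngtP x y) => //= _; apply: IH.
Qed.

Lemma strict_total_entries k D (f : {ffun 'I_k -> 'I_D} -> seq nat) m :
  injective f -> (forall u, size (f u) = m) ->
  strict_total (fun u v => lex_lt (f u) (f v)).
Proof.
move=> fI fm; split=> [u|v u w|u v ne]; first exact: lex_lt_irr.
  exact: lex_lt_trans.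
by apply: lex_lt_total; rewrite ?fm // (inj_eq fI).
Qed.

Lemma size_entry_seq k D (u : {ffun 'I_k -> 'I_D}) : size (entry_seq u) = k.
Proof. by rewrite size_map size_enum_ord. Qed.

Lemma strict_total_lex k D :
  strict_total (fun u v : {ffun 'I_k -> 'I_D} => lex_lt (entry_seq u) (entry_seq v)).
Proof. exact: strict_total_entries (@entry_seq_inj k D) (@size_entry_seq k D). Qed.

Lemma strict_total_colex k D : strict_total (@colex_lt k D).
Proof.
apply: (@strict_total_entries _ _ (fun u => rev (entry_seq u)) k) => [u v|u].
  by move/(can_inj (@revK _))/entry_seq_inj.
by rewrite size_rev size_entry_seq.
Qed.

Lemma card_pairs (T U : finType) (P : pred T) (Q : T -> pred U) :
  #|[set q : T * U | P q.1 && Q q.1 q.2]| = \sum_(t | P t) #|[set u | Q t u]|.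
Proof.
rewrite -sum1_card; under [RHS]eq_bigr => t _ do rewrite -sum1_card.
by rewrite pair_big_dep /=; apply: eq_bigl => q; rewrite !inE.
Qed.

(** Reading order of cells with equal entries: lower rows first, and from left to right in a row.
    Successive cells then never go down, so equal entries create no descent. *)
Definition rows_rev n : rel (cell n) :=
  fun x y => (y.1 < x.1) || (x.1 == y.1) && (x.2 < y.2).
Arguments rows_rev {n}.

Lemma strict_total_rows_rev n : strict_total (@rows_rev n).
Proof.
split=> [x|y x z|x y]; rewrite /rows_rev ?ltnn ?andbF //.
  rewrite -!val_eqE /=; lia.
by case: x y => [i j] [i' j'] /=; rewrite -pair_eqE /= -!val_eqE /=; lia.
Qed.

Section Shape.
Variables (n : nat) (la : seq nat).
Hypothesis la_part : is_partition n la.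

Lemma sumn_part : sumn la = n. Proof. by case/and3P: la_part => _ _ /eqP. Qed.

Lemma size_part : size la <= n.
Proof.
rewrite -sumn_part; case/and3P: la_part => _ + _.
by elim: la => //= x s IH /andP[x0 /IH]; lia.
Qed.

Lemma sum_part : \sum_(i < n) nth 0 la i = n.
Proof.
rewrite -[RHS]sumn_part sumnE (big_nth 0) big_mkord.
rewrite (big_ord_widen n (fun i => nth 0 la i) size_part) [RHS]big_mkcond /=.
by apply: eq_bigr => i _; case: ltnP => // /(nth_default 0) ->.
Qed.

Lemma nth_part_le i : nth 0 la i <= n.
Proof.
rewrite -sumn_part; elim: la i => [|x s IH] [|i] //=; first exact: leq_addr.
exact: leq_trans (IH i) (leq_addl _ _).
Qed.

Lemma card_shape : #|[pred x : cell n | in_shape la x]| = n.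
Proof.
rewrite -[RHS]sum_part -sum1_card.
rewrite (eq_bigl (fun x : cell n => xpredT x.1 && (x.2 < nth 0 la x.1))) //.
rewrite -(pair_big_dep xpredT (fun i j : 'I_n => j < nth 0 la i) (fun _ _ => 1)) /=.
apply: eq_bigr => i _; rewrite -[RHS](sum_lt_ord (nth_part_le i)) big_mkcond /=.
by apply: eq_bigr => j _; case: (_ < _).
Qed.

End Shape.

(** * Tableaux over an arbitrary ordered alphabet *)

Section Tableau.
Variables (n : nat) (A : eqType) (a0 : A) (S : pred (cell n)).
Implicit Types (F : {ffun cell n -> A}) (lt : rel A).

Definition tableau lt F : bool :=
  [&& [forall x, ~~ S x ==> (F x == a0)],
      [forall x : cell n, forall y : cell n,
         [&& S x, S y, (x.1 == y.1 :> nat) & (y.2 == (x.2).+1 :> nat)] ==>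
         (F x == F y) || lt (F x) (F y)]
    & [forall x : cell n, forall y : cell n,
         [&& S x, S y, (y.1 == (x.1).+1 :> nat) & (x.2 == y.2 :> nat)] ==>
         lt (F x) (F y)]].

Lemma tableauP lt F : reflect
  [/\ forall x, ~~ S x -> F x = a0,
      forall x y, S x -> S y -> x.1 = y.1 :> nat -> y.2 = x.2.+1 :> nat ->
        F x = F y \/ lt (F x) (F y)
    & forall x y, S x -> S y -> y.1 = x.1.+1 :> nat -> x.2 = y.2 :> nat ->
        lt (F x) (F y)]
  (tableau lt F).
Proof.
apply: (iffP and3P) => -[H1 H2 H3]; split.
- by move=> x xS; move/forallP/(_ x): H1; rewrite xS => /eqP.
- move=> x y xS yS /eqP e1 /eqP e2; move/forallP/(_ x)/forallP/(_ y): H2.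
  by rewrite xS yS e1 e2 /= => /orP[/eqP|]; [left | right].
- move=> x y xS yS /eqP e1 /eqP e2; move/forallP/(_ x)/forallP/(_ y): H3.
  by rewrite xS yS e1 e2.
- by apply/forallP => x; apply/implyP => xS; rewrite H1.
- apply/forallP => x; apply/forallP => y; apply/implyP => /and4P[xS yS /eqP e1 /eqP e2].
  by case: (H2 _ _ xS yS e1 e2) => ->; rewrite ?eqxx ?orbT.
- apply/forallP => x; apply/forallP => y; apply/implyP => /and4P[xS yS /eqP e1 /eqP e2].
  exact: H3.
Qed.

End Tableau.

Section CellOf.
Variables (n : nat) (D : {pred cell n}) (f : cell n -> nat).
Hypothesis cardD : #|D| = n.
Hypothesis fI : {in D &, injective f}.
Hypothesis f_lt : {in D, forall x, f x < n}.

(** The inverse of a numbering of the cells of [D] by 0, ..., n - 1; the default pair is never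
    returned, because such a numbering is onto. *)
Definition cell_of (i : 'I_n) : cell n :=
  odflt (i, i) [pick x | (x \in D) && (f x == i)].

Lemma cell_ofP i : cell_of i \in D /\ f (cell_of i) = i.
Proof.
rewrite /cell_of; case: pickP => [x /andP[xD /eqP fx] //|none].
have fD : {in D, forall x, f x < #|D|} by rewrite cardD.
have : (i : nat) \in [seq f x | x in D].
  by rewrite (perm_mem (perm_in_iota fI fD)) mem_iota /= cardD.
by case/imageP => x xD ix; move: (none x); rewrite xD ix eqxx.
Qed.

Lemma cell_of_in i : cell_of i \in D. Proof. by case: (cell_ofP i). Qed.
Lemma cell_ofE i : f (cell_of i) = i. Proof. by case: (cell_ofP i). Qed.

Lemma cell_ofK x (i : 'I_n) : x \in D -> f x = i -> cell_of i = x.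
Proof. by move=> xD fx; apply: fI; rewrite ?cell_of_in // cell_ofE. Qed.

Lemma cell_of_inj : injective cell_of.
Proof. by move=> i j e; apply: val_inj; rewrite /= -[LHS]cell_ofE e cell_ofE. Qed.

End CellOf.

Section Standardization.
Variables (n k D : nat) (la : seq nat).
Hypothesis la_part : is_partition n la.
Let A := {ffun 'I_k -> 'I_D.+1}.
Let a0 : A := [ffun=> ord0].
Let S : pred (cell n) := fun x => in_shape la x.
Implicit Types (F : {ffun cell n -> A}) (T : {ffun cell n -> 'I_n.+1})
  (v : {ffun 'I_n -> A}) (x y : cell n).

Notation ssyt_wrt := (tableau a0 (fun x : cell n => in_shape la x)).

Lemma is_SYTP T : reflect
  [/\ forall x, ~~ in_shape la x -> T x = ord0,
      forall x, in_shape la x -> 0 < T x,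
      {in S &, injective T},
      forall x y, in_shape la x -> in_shape la y -> x.1 = y.1 :> nat ->
        y.2 = x.2.+1 :> nat -> T x < T y
    & forall x y, in_shape la x -> in_shape la y -> y.1 = x.1.+1 :> nat ->
        x.2 = y.2 :> nat -> T x < T y]
  (is_SYT la T).
Proof.
apply: (iffP and5P) => -[H1 H2 H3 H4 H5]; split.
- move=> x xS; move/forallP/(_ x): H1; rewrite xS => /eqP e; exact: val_inj.
- by move=> x xS; move/forallP/(_ x): H2; rewrite xS.
- move=> x y xS yS e; move/forallP/(_ x)/forallP/(_ y): H3.
  by move: xS yS; rewrite !unfold_in e eqxx => -> -> /eqP.
- move=> x y xS yS /eqP e1 /eqP e2; move/forallP/(_ x)/forallP/(_ y): H4.
  by rewrite xS yS e1 e2.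
- move=> x y xS yS /eqP e1 /eqP e2; move/forallP/(_ x)/forallP/(_ y): H5.
  by rewrite xS yS e1 e2.
- by apply/forallP => x; apply/implyP => xS; rewrite H1.
- by apply/forallP => x; apply/implyP => xS; rewrite H2.
- apply/forallP => x; apply/forallP => y; apply/implyP => /and3P[xS yS /eqP e].
  by apply/eqP; apply: H3.
- apply/forallP => x; apply/forallP => y; apply/implyP => /and4P[xS yS /eqP e1 /eqP e2].
  exact: H4.
- apply/forallP => x; apply/forallP => y; apply/implyP => /and4P[xS yS /eqP e1 /eqP e2].
  exact: H5.
Qed.

Lemma cardS : #|S| = n. Proof. exact: card_shape. Qed.

Let reading F : rel (cell n) := lexr (@colex_lt k D.+1) F rows_rev.

Lemma strict_total_reading F : strict_total (reading F).
Proof. exact: strict_total_lexr (strict_total_colex _ _) (strict_total_rows_rev n). Qed.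

Section FromPair.
Variables (T : {ffun cell n -> 'I_n.+1}).
Hypothesis T_syt : is_SYT la T.

Let f x := (T x).-1.

Lemma SYT_predK x : in_shape la x -> T x = (f x).+1 :> nat.
Proof. by case/is_SYTP: T_syt => _ T0 _ _ _ /T0; rewrite /f; case: (T x : nat). Qed.

Lemma SYT_pred_inj : {in S &, injective f}.
Proof.
case/is_SYTP: (T_syt) => _ _ TI _ _ x y xS yS e; apply: TI => //.
by apply: val_inj; rewrite /= !SYT_predK // e.
Qed.

Lemma SYT_pred_lt : {in S, forall x, f x < n}.
Proof. by move=> x xS; rewrite -ltnS -SYT_predK. Qed.

Let c := cell_of S f.

Lemma SYT_cell_in i : in_shape la (c i).
Proof. exact: (cell_of_in cardS SYT_pred_inj SYT_pred_lt). Qed.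

Lemma SYT_cellE i : f (c i) = i.
Proof. exact: (cell_ofE cardS SYT_pred_inj SYT_pred_lt). Qed.

Lemma SYT_cellK x (i : 'I_n) : in_shape la x -> f x = i -> c i = x.
Proof. exact: (cell_ofK cardS SYT_pred_inj SYT_pred_lt). Qed.

Lemma SYT_cell_inj : injective c.
Proof. exact: (cell_of_inj cardS SYT_pred_inj SYT_pred_lt). Qed.

Lemma row_of_cell (i : 'I_n) : row_of la T i.+1 = (c i).1.
Proof.
rewrite /row_of; case: pickP => [x /andP[xS /eqP Tx]|none].
  by rewrite (@SYT_cellK x i) //; apply: succn_inj; rewrite -SYT_predK.
have := none (c i); rewrite SYT_cell_in /= SYT_predK ?SYT_cell_in //.
by rewrite SYT_cellE eqxx.
Qed.

Lemma des_set_cell (i j : 'I_n) : j = i.+1 :> nat -> des_set la T j = ((c i).1 < (c j).1).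
Proof.
(* Labels start at 1: [c i] carries the label [i + 1 = j], and [c j] the label [j + 1]. *)
move=> ij; have e : row_of la T j = (c i).1 by rewrite ij row_of_cell.
by rewrite /des_set row_of_cell ltn_ord e {1}ij.
Qed.

Lemma SYT_row_lt x y : in_shape la x -> in_shape la y -> x.1 = y.1 -> x.2 < y.2 ->
  f x < f y.
Proof.
case/is_SYTP: (T_syt) => _ _ _ Trow _ xS yS ex xy.
suff : T x < T y by rewrite !SYT_predK.
case: y yS ex xy => i [j jn] /= yS ex.
elim: j jn yS => // j IH jn yS; rewrite ltnS leq_eqVlt => /orP[/eqP e|xj].
  by apply: Trow; rewrite /= ?ex ?e.
have jn' : j < n by lia.
have zS : in_shape la (i, Ordinal jn') by move: yS; rewrite /in_shape /=; lia.
apply: ltn_trans (IH jn' zS xj) _.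
by apply: Trow => //; rewrite /= ?ex.
Qed.

Lemma SYT_same_row x y : in_shape la x -> in_shape la y -> x.1 = y.1 -> f x < f y ->
  x.2 < y.2.
Proof.
move=> xS yS e xy; case: (ltngtP x.2 y.2) => // [yx|/val_inj e2].
  by have := SYT_row_lt yS xS (esym e) yx; lia.
by move: xy; rewrite (_ : x = y) ?ltnn //; case: x y e e2 {xS yS} => ? ? [? ?] /= -> ->.
Qed.

Variable v : {ffun 'I_n -> A}.
Hypothesis v_inc : increasing_rows (des_set la T) v.

(** The inverse of standardization: the cell labelled [i + 1] receives [v i]. Inside the shape
    [insub] always succeeds. *)
Definition fill : {ffun cell n -> A} :=
  [ffun x => if in_shape la x then oapp v a0 (insub (f x)) else a0].

Lemma fill_cell i : fill (c i) = v i.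
Proof.
by rewrite ffunE SYT_cell_in SYT_cellE insubT //= => ?; congr (v _); apply: val_inj.
Qed.

(** For neighbouring labels either the entry increases, or it stays equal and the label is no
    descent. In the latter case the next cell is in a higher row, or further right in the same row,
    which is the order [rows_rev]. *)
Lemma reading_fill i j : reading fill (c i) (c j) = (i < j).
Proof.
have st := strict_total_inj SYT_cell_inj (strict_total_reading fill).
apply: (strict_total_adjacent st) => {}i {}j ij; rewrite /reading /lexr !fill_cell.
move/forallP/(_ i)/forallP/(_ j): v_inc; rewrite (des_set_cell ij) ij eqxx /=.
case/orP=> [->//|/andP[-> ]]; rewrite -leqNgt => le; apply/orP; right => /=.
rewrite /rows_rev; case: (ltngtP (c j).1 (c i).1) le => //= /val_inj e _.
by rewrite e eqxx /=; apply: SYT_same_row; rewrite ?SYT_cell_in // !SYT_cellE ij.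
Qed.

Lemma reading_fill_cells x y : in_shape la x -> in_shape la y ->
  reading fill x y = (f x < f y).
Proof.
move=> xS yS; have := reading_fill (Ordinal (SYT_pred_lt xS)) (Ordinal (SYT_pred_lt yS)).
by rewrite (@SYT_cellK x) // (@SYT_cellK y).
Qed.

Lemma SYT_rank x : in_shape la x -> f x = rank S (reading fill) x.
Proof.
move=> xS; apply: (rank_unique (strict_total_reading fill) SYT_pred_inj) => //.
  by move=> y yS; rewrite cardS; apply: SYT_pred_lt.
by move=> y z yS zS; rewrite reading_fill_cells.
Qed.

Lemma fill_ssyt : ssyt_wrt (@colex_lt k D.+1) fill.
Proof.
case/is_SYTP: (T_syt) => _ _ _ Trow Tcol; apply/tableauP; split.
- by move=> x /negbTE xS; rewrite ffunE xS.
- move=> x y xS yS e1 e2; have := Trow _ _ xS yS e1 e2.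
  rewrite !SYT_predK // ltnS -reading_fill_cells //.
  by case/orP=> [|/andP[/eqP]]; [right | left].
- move=> x y xS yS e1 e2; have := Tcol _ _ xS yS e1 e2.
  rewrite !SYT_predK // ltnS -reading_fill_cells //.
  (* Equal entries in a column would make [rows_rev] read the lower cell first, against the labels
     of [T]. *)
  case/orP=> [//|/andP[_]]; rewrite /rows_rev -val_eqE /= e1; lia.
Qed.

Lemma fill_weight (h : A -> nat) : \sum_(x : cell n | in_shape la x) h (fill x) = \sum_i h (v i).
Proof.
pose g m := h (oapp v a0 (insub m)).
rewrite (eq_bigr (fun x => g (f x))) => [|x xS]; last by rewrite ffunE xS.
have fS : {in S, forall x, f x < #|S|} by rewrite cardS; exact: SYT_pred_lt.
rewrite (sum_in_bij g SYT_pred_inj fS) cardS; apply: eq_bigr => i _.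
by rewrite /g insubT //= => ?; congr (h (v _)); apply: val_inj.
Qed.

End FromPair.

Section FromSSYT.
Variable F : {ffun cell n -> A}.
Hypothesis F_ssyt : ssyt_wrt (@colex_lt k D.+1) F.

Let f := rank S (reading F).
Let st := strict_total_reading F.

Let fI : {in S &, injective f} := rank_inj st.
Let f_lt : {in S, forall x, f x < n}.
Proof. by move=> x xS; rewrite -[X in _ < X]cardS; apply: rank_lt_card. Qed.

Definition std_tab : {ffun cell n -> 'I_n.+1} :=
  [ffun x => if in_shape la x then inord (f x).+1 else ord0].
Definition std_rows : {ffun 'I_n -> A} := [ffun i => F (cell_of S f i)].

Lemma std_tabE x : in_shape la x -> std_tab x = (f x).+1 :> nat.
Proof. by move=> xS; rewrite ffunE xS inordK // ltnS; apply: f_lt. Qed.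

Lemma std_tab_syt : is_SYT la std_tab.
Proof.
case/tableauP: F_ssyt => Fout Frow Fcol; apply/is_SYTP; split.
- by move=> x /negbTE xS; rewrite ffunE xS.
- by move=> x xS; rewrite std_tabE.
- by move=> x y xS yS /(congr1 val); rewrite /= !std_tabE // => -[]; apply: fI.
- move=> x y xS yS e1 e2; rewrite !std_tabE // ltnS /f (rank_ltE st) // /reading /lexr.
  case: (Frow _ _ xS yS e1 e2) => -> //; rewrite eqxx /= orbC.
  by rewrite /rows_rev -val_eqE /= e1 e2 eqxx ltnSn orbT.
- move=> x y xS yS e1 e2; rewrite !std_tabE // ltnS /f (rank_ltE st) // /reading /lexr.
  by rewrite Fcol.
Qed.

Let cF := cell_of S f.
Let cT := cell_of S (fun x => (std_tab x).-1).

Lemma std_cell : cT =1 cF.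
Proof.
move=> i; apply: (SYT_cellK std_tab_syt).
  exact: (cell_of_in cardS fI f_lt).
rewrite std_tabE; last exact: (cell_of_in cardS fI f_lt).
exact: (cell_ofE cardS fI f_lt).
Qed.

(** Two cells that are consecutive in the reading order either have increasing entries, or equal
    ones with the second cell not in a lower row, hence no descent. *)
Lemma std_rows_inc : increasing_rows (des_set la std_tab) std_rows.
Proof.
apply/forallP => i; apply/forallP => j; apply/implyP => /eqP ij.
rewrite (des_set_cell std_tab_syt ij) -/cT !std_cell !ffunE.
have cS l : cF l \in S by exact: (cell_of_in cardS fI f_lt).
have : reading F (cF i) (cF j).
  rewrite -(rank_ltE (D := S) st) // -/f /cF.
  by rewrite !(cell_ofE cardS fI f_lt) ij.
rewrite /reading /lexr => /orP[->//|/andP[-> rc]]; rewrite /= orbC.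
by move: rc; rewrite /rows_rev -val_eqE /= -leqNgt => rc; apply/orP; left; lia.
Qed.

Lemma fill_std : fill std_tab std_rows = F.
Proof.
apply/ffunP => x; rewrite ffunE; case: ifP => [xS|/negbT xS]; last first.
  by case/tableauP: F_ssyt => /(_ _ xS) ->.
rewrite std_tabE // insubT /=; first exact: f_lt.
move=> lt; rewrite ffunE; congr (F _).
exact: (cell_ofK cardS fI f_lt).
Qed.

End FromSSYT.

Lemma std_fill T v : is_SYT la T -> increasing_rows (des_set la T) v ->
  std_tab (fill T v) = T /\ std_rows (fill T v) = v.
Proof.
move=> Ts vi; have Te : std_tab (fill T v) = T.
  apply/ffunP => x; apply: val_inj; case: (boolP (in_shape la x)) => xS.
    by rewrite /= std_tabE // -SYT_rank // -SYT_predK.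
  by case/is_SYTP: (Ts) => /(_ _ xS) -> _ _ _ _; rewrite ffunE (negbTE xS).
split=> //; apply/ffunP => i.
by rewrite ffunE -(std_cell (fill_ssyt Ts vi)) Te (fill_cell Ts).
Qed.

Lemma card_ssyt_standardization (d : 'I_k -> nat) :
  #|[set F : {ffun cell n -> A} | ssyt_wrt (@colex_lt k D.+1) F &
             [forall t, \sum_(x : cell n | in_shape la x) F x t == d t]]| =
  \sum_(T : {ffun cell n -> 'I_n.+1} | is_SYT la T) #|[set v : {ffun 'I_n -> A} |
     increasing_rows (des_set la T) v & [forall t, \sum_a v a t == d t]]|.
Proof.
rewrite -card_pairs.
apply: (card_bij_in (f := fun F => (std_tab F, std_rows F)) (g := fun q => fill q.1 q.2)).
- move=> F; rewrite !inE => /andP[Fs /forallP Fd]; split; last exact: fill_std.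
  rewrite /= std_tab_syt // std_rows_inc //=; apply/forallP => t; rewrite -(eqP (Fd t)).
  rewrite -{2}(fill_std Fs).
  by rewrite (fill_weight (std_tab_syt Fs) (std_rows F) (fun a : A => a t)).
- case=> T v; rewrite !inE /= => /and3P[Ts vi /forallP vd]; split.
    rewrite fill_ssyt //=; apply/forallP => t; rewrite -(eqP (vd t)).
    by rewrite (fill_weight Ts v (fun a : A => a t)).
  by case: (std_fill Ts vi) => -> ->.
Qed.

End Standardization.

(** * Independence of the order of the alphabet *)

(** The minimum at [i + 1] and the maximum at [i] involve the same two numbers and add up to their
    sum. At the ends there remain [m 0] and, since [m N = 0], the last value of [k]. *)
Lemma sum_interlace (m k : nat -> nat) N : m N = 0 ->
  \sum_(i < N) (maxn (m i.+1) (k i) +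
     minn (m i) (if i : nat is i'.+1 then k i' else m 0)) =
  \sum_(i < N) m i + \sum_(i < N) k i.
Proof.
case: N => [|N] mN; first by rewrite !big_ord0.
rewrite big_split /= big_ord_recr [X in _ + X]big_ord_recl [X in _ = X + _]big_ord_recl.
rewrite [X in _ = _ + X]big_ord_recr /= mN max0n minnn.
have : \sum_(i < N) maxn (m i.+1) (k i) + \sum_(i < N) minn (m (bump 0 i)) (k (0 + i)) =
   \sum_(i < N) m (bump 0 i) + \sum_(i < N) k i.
  by rewrite -!big_split; apply: eq_bigr => i _; rewrite /bump /= add1n add0n addnC addn_min_max.
by move=> e; rewrite addnCA (addnAC _ (k N)) e -!addnA.
Qed.

Section Strips.
Variable n : nat.
Notation shape := {ffun 'I_n -> 'I_n.+1}.
Implicit Types (mu nu ka : shape) (i j : nat).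

Definition part mu i : nat := if insub i is Some i' then mu i' else 0.

Lemma part_ord mu (i : 'I_n) : part mu i = mu i.
Proof. by rewrite /part insubT //= => ?; congr (nat_of_ord (mu _)); apply: val_inj. Qed.

Lemma part_out mu i : n <= i -> part mu i = 0.
Proof. by move=> ni; rewrite /part insubN // -leqNgt. Qed.

Definition weight mu : nat := \sum_i mu i.

Lemma weightE mu : weight mu = \sum_(i < n) part mu i.
Proof. by apply: eq_bigr => i _; rewrite part_ord. Qed.

(** Interlacing of row lengths: [nu] arises from [mu] by removing a horizontal strip. *)
Definition strip mu nu : bool :=
  [forall i : 'I_n, part mu i.+1 <= nu i <= mu i].

Definition strip_of (c : nat) mu nu : bool :=
  strip mu nu && (weight mu == weight nu + c).

(** The number of Gelfand-Tsetlin patterns with top row [mu] and strip sizes [cs], that is, a Kostka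
    number when [mu] is a partition. *)
Fixpoint strip_chains (cs : seq nat) mu : nat :=
  if cs is c :: cs' then \sum_(nu | strip_of c mu nu) strip_chains cs' nu
  else (mu == [ffun=> ord0]).

(** [lo] and [hi] bound row [i] of a shape between [mu] and [ka]. In row 0 there is no upper bound
    from [ka], and [part mu 0] is repeated. *)
Definition lo mu ka i : nat := maxn (part mu i.+1) (part ka i).
Definition hi mu ka i : nat :=
  minn (part mu i) (if i is i'.+1 then part ka i' else part mu 0).

Lemma strip2E mu nu ka :
  strip mu nu && strip nu ka = [forall i : 'I_n, lo mu ka i <= nu i <= hi mu ka i].
Proof.
apply/andP/forallP => [[/forallP H1 /forallP H2] i|H].
  have := H1 i; have := H2 i; rewrite /lo /hi !part_ord geq_max leq_min.
  move=> /andP[_ ->] /andP[-> ->] /=.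
  case: i => -[|i] iN /=.
    by have /andP[_ +] := H1 (Ordinal iN); rewrite -(part_ord mu).
  have iN' : i < n by lia.
  have /andP[+ _] := H2 (Ordinal iN'); rewrite -!part_ord /=.
  by rewrite (part_ord nu (Ordinal iN)).
split; apply/forallP => i; have := H i; rewrite /lo /hi geq_max leq_min !part_ord.
  by move=> /andP[/andP[-> _] /andP[-> _]].
case/andP=> /andP[_ ->] _; rewrite andbT.
case: (ltnP i.+1 n) => iN; last by rewrite part_out.
have /andP[_] := H (Ordinal iN); rewrite /hi /= leq_min => /andP[_].
by rewrite -(part_ord nu (Ordinal iN)) /= (part_ord ka).
Qed.

Lemma sum_lo_hi mu ka :
  \sum_(i < n) (lo mu ka i + hi mu ka i) = weight mu + weight ka.
Proof.
by rewrite !weightE -sum_interlace // part_out.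
Qed.

(* Bender-Knuth in Gelfand-Tsetlin coordinates: the parts of the middle shape
   range independently over intervals, and each interval is reflected. *)
Lemma card_strip2_swap b c mu ka :
  #|[set nu | strip_of b mu nu & strip_of c nu ka]| =
  #|[set nu | strip_of c mu nu & strip_of b nu ka]|.
Proof.
pose f nu : shape := [ffun i : 'I_n => inord (lo mu ka i + hi mu ka i - nu i)].
suff H b' c' nu : strip_of b' mu nu && strip_of c' nu ka ->
    strip_of c' mu (f nu) && strip_of b' (f nu) ka /\ f (f nu) = nu.
  by apply: (card_bij_in (f := f) (g := f)) => nu; rewrite !inE; apply: H.
rewrite /strip_of andbACA strip2E => /andP[/forallP Hnu /andP[/eqP wmu /eqP wnu]].
have hin i : hi mu ka i <= n.
  rewrite /hi; case: (ltnP i n) => iN; last by rewrite part_out // min0n.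
  by rewrite -[i]/(val (Ordinal iN)) part_ord geq_min -ltnS ltn_ord.
have fE (i : 'I_n) : f nu i = lo mu ka i + hi mu ka i - nu i :> nat.
  by rewrite ffunE inordK //; have := Hnu i; have := hin i; lia.
(* The reflection turns the weight of [nu] into its complement in this sum, so the two strip sizes
   are exchanged. *)
have wf : weight (f nu) + weight nu = weight mu + weight ka.
  rewrite -[RHS]sum_lo_hi -big_split /=; apply: eq_bigr => i _.
  by rewrite fE; have := Hnu i; lia.
split.
  rewrite andbACA strip2E; apply/andP; split; last by apply/andP; split; apply/eqP; lia.
  by apply/forallP => i; rewrite fE; have := Hnu i; lia.
apply/ffunP => i; apply: val_inj; rewrite ffunE /= fE.
have -> : lo mu ka i + hi mu ka i - (lo mu ka i + hi mu ka i - nu i) = nu i.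
  by have := Hnu i; lia.
by rewrite inord_val.
Qed.

Lemma strip_chains_swap b c cs mu :
  strip_chains (b :: c :: cs) mu = strip_chains (c :: b :: cs) mu.
Proof.
have E x y : strip_chains (x :: y :: cs) mu =
    \sum_ka #|[set nu | strip_of x mu nu & strip_of y nu ka]| * strip_chains cs ka.
  rewrite /= (exchange_big_dep xpredT) //=; apply: eq_bigr => ka _.
  by rewrite sum_nat_const; congr (_ * _); apply: eq_card => nu; rewrite !inE.
by rewrite !E; apply: eq_bigr => ka _; rewrite card_strip2_swap.
Qed.

Lemma strip_chains_cons c cs cs' : strip_chains cs =1 strip_chains cs' ->
  strip_chains (c :: cs) =1 strip_chains (c :: cs').
Proof. by move=> e mu /=; apply: eq_bigr => nu _; rewrite e. Qed.

Lemma strip_chains_perm cs cs' : perm_eq cs cs' -> strip_chains cs =1 strip_chains cs'.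
Proof.
elim: cs cs' => [|c cs IH] cs' e; first by move/perm_size: e; case: cs'.
have cin : c \in cs' by rewrite -(perm_mem e) mem_head.
case/splitPr: cin e => u w e mu.
have /IH e' : perm_eq cs (u ++ w).
  by rewrite -(perm_cons c) (permPl e) -[c :: w]cat1s perm_catCA perm_refl.
(* The letter [c] travels through [u] by swaps of neighbours. *)
rewrite (strip_chains_cons _ e'); elim: u mu {e e'} => [//|x u IHu] mu.
by rewrite !cat_cons strip_chains_swap; apply: strip_chains_cons.
Qed.

Definition inside mu (x : cell n) : bool := x.2 < mu x.1.

Lemma card_inside mu : #|[pred x | inside mu x]| = weight mu.
Proof.
rewrite -sum1_card (eq_bigl (fun x : cell n => xpredT x.1 && (x.2 < mu x.1))) //.
rewrite -(pair_big_dep xpredT (fun i j : 'I_n => j < mu i) (fun _ _ => 1)) /=.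
apply: eq_bigr => i _; rewrite sum1_card; apply: card_ltn_ord.
by rewrite -ltnS ltn_ord.
Qed.

Lemma inside_le mu nu (i i' : 'I_n) :
  (forall j : 'I_n, inside nu (i, j) -> inside mu (i', j)) -> nu i <= mu i'.
Proof.
move=> H; rewrite leqNgt; apply/negP => lt.
have jn : mu i' < n by apply: leq_trans lt _; rewrite -ltnS ltn_ord.
by have := H (Ordinal jn) lt; rewrite /inside /= ltnn.
Qed.

Lemma inside_inj mu nu : inside mu =1 inside nu -> mu = nu.
Proof.
move=> H; apply/ffunP => i; apply/val_inj/eqP => /=.
by rewrite eqn_leq !inside_le // => j; rewrite H.
Qed.

Lemma down_closed_card (q : pred 'I_n) :
  (forall i j : 'I_n, j = i.+1 :> nat -> q j -> q i) ->
  forall j : 'I_n, (j < #|q|) = q j.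
Proof.
move=> qS; have q_le (i j : 'I_n) : i <= j -> q j -> q i.
  case: j => j jn /=; elim: j jn => [|j IH] jn; rewrite leq_eqVlt.
    by case/orP=> [/eqP e|//]; rewrite (_ : i = Ordinal jn) //; apply: val_inj.
  case/orP=> [/eqP e|ij]; first by rewrite (_ : i = Ordinal jn) //; apply: val_inj.
  have jn' : j < n by lia.
  by move=> qj; apply: (IH jn') => //; apply: qS qj.
move=> j; apply/idP/idP => [|qj].
  apply: contraTT => qj; rewrite -leqNgt -[X in _ <= X](card_ltn_ord (ltnW (ltn_ord j))).
  apply: subset_leq_card; apply/subsetP => i qi; rewrite inE ltnNge.
  by apply: contra qj => ji; apply: q_le ji qi.
rewrite -(card_ltn_ord (ltn_ord j)); apply: subset_leq_card; apply/subsetP => i.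
by rewrite inE ltnS => ij; apply: q_le ij qj.
Qed.

Definition decreasing mu : bool := [forall i : 'I_n, part mu i.+1 <= mu i].

Lemma strip_decreasing mu nu : strip mu nu -> decreasing nu.
Proof.
move/forallP => H; apply/forallP => i; case: (ltnP i.+1 n) => iN; last by rewrite part_out.
have := H (Ordinal iN); have := H i.
by rewrite -[i.+1]/(val (Ordinal iN)) !part_ord /=; lia.
Qed.

(** * Fillings counted by removing the largest letter *)

Section Letters.
Variables (A : finType) (a0 : A) (c : A -> nat).
Implicit Types (s : seq A) (F G : {ffun cell n -> A}).

(* s lists the alphabet from the largest letter to the smallest. *)
Definition index_gt s : rel A := fun u v => index v s < index u s.

Definition filling s mu F : bool :=
  [&& tableau a0 (inside mu) (index_gt s) F,
      [forall x, inside mu x ==> (F x \in s)]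
    & all (fun b => #|[pred x | inside mu x & F x == b]| == c b) s].

Lemma fillingP s mu F : reflect
  [/\ tableau a0 (inside mu) (index_gt s) F,
      forall x, inside mu x -> F x \in s
    & forall b, b \in s -> #|[pred x | inside mu x & F x == b]| = c b]
  (filling s mu F).
Proof.
apply: (iffP and3P) => -[H1 H2 H3]; split=> //.
- by move=> x xmu; move/forallP/(_ x): H2; rewrite xmu.
- by move=> b bs; apply/eqP/(allP H3).
- by apply/forallP => x; apply/implyP/H2.
- by apply/allP => b bs; rewrite H3.
Qed.

Lemma card_filling_nil mu : #|[set F | filling [::] mu F]| = (mu == [ffun=> ord0]).
Proof.
have out0 (x : cell n) : inside [ffun=> ord0] x = false by rewrite /inside ffunE.
case: eqP => [->|ne].
  rewrite (_ : [set F | _] = [set [ffun=> a0]]) ?cards1 //.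
  apply/setP => F; rewrite !inE; apply/fillingP/eqP => [[/tableauP[H _ _] _ _]|->].
    by apply/ffunP => x; rewrite ffunE H // out0.
  split=> [|x|//]; last by rewrite out0.
  by apply/tableauP; split=> [x _|x y|x y]; rewrite ?ffunE // out0.
rewrite (_ : [set F | _] = set0) ?cards0 //; apply/setP => F; rewrite !inE.
apply/negP => /fillingP[_ H _]; apply: ne; apply: inside_inj => x.
by rewrite out0; apply/negP => /H.
Qed.

Definition without a mu F : shape :=
  [ffun i => inord #|[pred j : 'I_n | inside mu (i, j) && (F (i, j) != a)]|].

Definition erase nu F : {ffun cell n -> A} :=
  [ffun x => if inside nu x then F x else a0].

Definition append a mu nu F : {ffun cell n -> A} :=
  [ffun x => if inside nu x then F x else if inside mu x then a else a0].

Section Step.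
Variables (a : A) (s : seq A) (mu : shape).
Hypothesis mu_dec : decreasing mu.
Hypothesis a_notin : a \notin s.

Lemma index_gt_head u v : u \in s -> index_gt (a :: s) u v = (v == a) || index_gt s u v.
Proof.
move=> us; rewrite /index_gt /=; have -> : (a == u) = false.
  by apply: contraNF a_notin => /eqP ->.
by rewrite (eq_sym a v); case: eqP.
Qed.

Lemma index_gt_max v : index_gt (a :: s) a v = false.
Proof. by rewrite /index_gt /= eqxx. Qed.

(** Since [a] is the largest letter, only [a] can follow [a] in a row. The other cells form an
    initial segment of the row, and its length is the cardinality used in [without]. *)
Lemma inside_without F : filling (a :: s) mu F ->
  forall x, inside (without a mu F) x = inside mu x && (F x != a).
Proof.
case/fillingP=> /tableauP[_ Frow _] _ _ [i j].
rewrite {1}/inside /= ffunE inordK; last by rewrite ltnS -[X in _ <= X]card_ord max_card.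
pose q := [pred j : 'I_n | inside mu (i, j) && (F (i, j) != a)].
apply: (@down_closed_card q) => j1 j2 e; rewrite /q /= => /andP[in2 ne].
have in1 : inside mu (i, j1) by move: in2; rewrite /inside /= e; lia.
rewrite in1 /=; apply: contra ne => /eqP F1.
by have := Frow (i, j1) (i, j2) in1 in2 erefl e; rewrite F1 index_gt_max => -[<-|].
Qed.

Lemma inside_up (x y : cell n) : inside mu y -> y.1 = x.1.+1 :> nat -> x.2 = y.2 -> inside mu x.
Proof.
rewrite /inside => yin e1 ->; apply: leq_trans yin _.
by move/forallP/(_ x.1): mu_dec; rewrite -e1 part_ord.
Qed.

Lemma filling_without F : filling (a :: s) mu F ->
  strip_of (c a) mu (without a mu F) && filling s (without a mu F) (erase (without a mu F) F).
Proof.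
move=> Ff; have inE' := inside_without Ff; set nu := without a mu F in inE' *.
case/fillingP: Ff => /tableauP[Fout Frow Fcol] Fs Fc.
have nuS x : inside nu x -> F x \in s.
  by rewrite inE' => /andP[/Fs]; rewrite in_cons => /orP[/eqP ->|//]; rewrite eqxx.
have nu_mu x : inside nu x -> inside mu x by rewrite inE' => /andP[].
have gt_s u v : u \in s -> v \in s -> index_gt (a :: s) u v -> index_gt s u v.
  move=> us vs; rewrite index_gt_head // => /orP[/eqP va|//].
  by case/negP: a_notin; rewrite -va.
apply/andP; split; [apply/andP; split|].
- apply/forallP => i; apply/andP; split; last by apply: inside_le => j /nu_mu.
  case: (ltnP i.+1 n) => iN; last by rewrite part_out.
  rewrite -[i.+1]/(val (Ordinal iN)) part_ord; apply: inside_le => j jin.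
  have jin' : inside mu (i, j) by apply: inside_up jin _ _.
  (* An [a] in the upper cell would require a letter larger than [a] below it. *)
  rewrite inE' jin' /=; apply/eqP => e.
  by have := Fcol (i, j) (Ordinal iN, j) jin' jin erefl erefl; rewrite e index_gt_max.
- rewrite -!card_inside -(Fc a) ?mem_head //.
  rewrite -!sum1_card (bigID (fun x => F x == a)) /= addnC; apply/eqP; congr (_ + _).
    by apply: eq_bigl => x; rewrite !inE inE'.
- apply/fillingP; split.
  + apply/tableauP; split.
    * by move=> x /negbTE xnu; rewrite ffunE xnu.
    * move=> x y xin yin e1 e2; rewrite !ffunE xin yin.
      have [->|lt] := Frow _ _ (nu_mu _ xin) (nu_mu _ yin) e1 e2; [by left | right].
      by apply: gt_s lt; apply: nuS.
    * move=> x y xin yin e1 e2; rewrite !ffunE xin yin.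
      by apply: gt_s (Fcol _ _ (nu_mu _ xin) (nu_mu _ yin) e1 e2); apply: nuS.
  + by move=> x xin; rewrite ffunE xin nuS.
  + move=> b bs; rewrite -Fc ?in_cons ?bs ?orbT //; apply: eq_card => x; rewrite !inE.
    rewrite ffunE inE'; have ba : b != a by apply: contraNneq a_notin => <-.
    by case: (inside mu x) => //=; case: (eqVneq (F x) a) => [->|] //=; rewrite eq_sym (negbTE ba).
Qed.

Lemma append_erase F : filling (a :: s) mu F ->
  append a mu (without a mu F) (erase (without a mu F) F) = F.
Proof.
move=> Ff; apply/ffunP => x; rewrite !ffunE (inside_without Ff).
case/fillingP: Ff => /tableauP[Fout _ _] _ _.
case: (boolP (inside mu x)) => [xin|/Fout ->] //=.
by case: eqP.
Qed.

Lemma filling_append nu F : strip_of (c a) mu nu -> filling s nu F ->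
  [/\ filling (a :: s) mu (append a mu nu F),
      without a mu (append a mu nu F) = nu
    & erase nu (append a mu nu F) = F].
Proof.
move=> /andP[/forallP st /eqP w] /fillingP[/tableauP[Fout Frow Fcol] Fs Fc].
have nu_mu x : inside nu x -> inside mu x.
  by move=> xin; apply: leq_trans xin _; case/andP: (st x.1).
have FneA x : inside nu x -> (F x == a) = false.
  by move/Fs => xs; apply: contraNF a_notin => /eqP <-.
pose G := append a mu nu F.
have Gnu x : inside nu x -> G x = F x by rewrite ffunE => ->.
have Gmu x : inside nu x = false -> inside mu x -> G x = a by rewrite ffunE => -> ->.
(* Interlacing puts the cell above any cell of [mu] into [nu], so no two added letters [a] share a
   column. *)
have above (x y : cell n) : inside mu y -> y.1 = x.1.+1 :> nat -> x.2 = y.2 -> inside nu x.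
  rewrite /inside => yin e1 ->; apply: leq_trans yin _.
  by case/andP: (st x.1) => + _; rewrite -e1 part_ord.
have Ga x : inside mu x -> (G x == a) = ~~ inside nu x.
  move=> xin; case: (boolP (inside nu x)) => [xn|/negbTE xn].
    by rewrite Gnu // FneA.
  by rewrite Gmu // eqxx.
have Gf : filling (a :: s) mu G.
  apply/fillingP; split.
  - apply/tableauP; split.
    + move=> x xout; rewrite ffunE (negbTE xout).
      by case: ifP => // /nu_mu; rewrite (negbTE xout).
    + move=> x y xin yin e1 e2; case: (boolP (inside nu y)) => [yn|/negbTE yn].
        have xn : inside nu x by move: yn; rewrite /inside e2 (val_inj e1); lia.
        rewrite !Gnu //; have [->|lt] := Frow _ _ xn yn e1 e2; [by left|right].
        by rewrite index_gt_head ?lt ?orbT ?Fs.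
      rewrite (Gmu _ yn yin); case: (boolP (inside nu x)) => [xn|/negbTE xn].
        by right; rewrite Gnu // index_gt_head ?eqxx ?Fs.
      by left; rewrite Gmu.
    + move=> x y xin yin e1 e2; have xn := above _ _ yin e1 (val_inj e2).
      rewrite (Gnu _ xn) index_gt_head ?Fs //.
      case: (boolP (inside nu y)) => [yn|/negbTE yn]; last by rewrite Gmu ?eqxx.
      by rewrite Gnu // Fcol // orbT.
  - move=> x xin; rewrite in_cons Ga //; case: (boolP (inside nu x)) => //= xn.
    by rewrite Gnu // Fs.
  - move=> b; rewrite in_cons => /orP[/eqP ->|bs].
      apply/eqP; rewrite -(eqn_add2l (weight nu)) -w -!card_inside -!sum1_card.
      rewrite [X in _ == X](bigID (inside nu)) /=; apply/eqP; congr (_ + _).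
        apply: eq_bigl => x; rewrite !inE.
        by case: (boolP (inside nu x)) => [/nu_mu ->|]; rewrite ?andbF.
      by apply: eq_bigl => x; rewrite !inE; case: (boolP (inside mu x)) => //= /Ga ->.
    rewrite -Fc //; apply: eq_card => x; rewrite !inE.
    case: (boolP (inside nu x)) => [xn|/negbTE xn]; first by rewrite nu_mu // Gnu.
    case: (boolP (inside mu x)) => //= xin; rewrite Gmu //.
    by apply: contraNF a_notin => /eqP ->.
have nuE : without a mu G = nu.
  apply: inside_inj => x; rewrite inside_without //.
  case: (boolP (inside mu x)) => [xin|xout]; first by rewrite Ga ?negbK.
  by symmetry; apply: contraNF xout => /nu_mu.
split=> //; apply/ffunP => x; rewrite ffunE; case: (boolP (inside nu x)) => [/Gnu //|xn].
by rewrite Fout.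
Qed.

Lemma card_filling_cons : #|[set F | filling (a :: s) mu F]| =
  \sum_(nu | strip_of (c a) mu nu) #|[set F | filling s nu F]|.
Proof.
rewrite -card_pairs.
apply: (card_bij_in (f := fun F => (without a mu F, erase (without a mu F) F))
                    (g := fun q => append a mu q.1 q.2)) => [F|[nu F]]; rewrite !inE.
  by move=> Ff; rewrite filling_without ?append_erase.
by case/andP=> /= st Ff; case: (filling_append st Ff) => -> -> ->.
Qed.

End Step.

Lemma card_filling s mu : uniq s -> decreasing mu ->
  #|[set F | filling s mu F]| = strip_chains [seq c a | a <- s] mu.
Proof.
elim: s mu => [|a s IH] mu /=; first by move=> _ _; apply: card_filling_nil.
case/andP=> as_ us dmu; rewrite card_filling_cons //; apply: eq_bigr => nu /andP[st _].
exact/IH/strip_decreasing/st.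
Qed.

End Letters.

End Strips.

(** * Schur functions as sums over standard tableaux *)

Lemma decreasing_enumeration (A : finType) (lt : rel A) : strict_total lt ->
  exists s : seq A, [/\ uniq s, forall a, a \in s & index_gt s =2 lt].
Proof.
move=> st; case: (st) => li lt_tr ltot.
pose ge u v := (u == v) || lt v u.
have ge_tr : transitive ge.
  move=> v u w; rewrite /ge => /orP[/eqP -> //|vu] /orP[/eqP <-|wv]; first by rewrite vu orbT.
  by rewrite (lt_tr _ _ _ wv vu) orbT.
have ge_tot : total ge.
  by move=> u v; rewrite /ge; case: (eqVneq u v) => //= ne; rewrite orbC ltot.
pose s := sort ge (enum A); have sA a : a \in s by rewrite mem_sort mem_enum.
have us : uniq s by rewrite sort_uniq enum_uniq.
have idx_lt u v : index_gt s u v -> lt u v.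
  move=> i; have := sorted_ltn_index ge_tr (sort_sorted ge_tot (enum A)) _ _ (sA v) (sA u) i.
  by case/orP=> // /eqP e; move: i; rewrite /index_gt e ltnn.
exists s; split=> // u v; apply/idP/idP => [/idx_lt //|uv].
case: (ltngtP (index u s) (index v s)) => // [/idx_lt vu|e].
  by rewrite (strict_total_asym st uv) in vu.
by move: uv; rewrite -(nth_index u (sA v)) -e nth_index ?li.
Qed.

Section OrderIndependence.
Variables (n : nat) (A : finType) (a0 : A) (mu : {ffun 'I_n -> 'I_n.+1}).
Hypothesis mu_dec : decreasing mu.
Implicit Types (F : {ffun cell n -> A}) (lt : rel A).

Definition content F : {ffun A -> 'I_(#|{: cell n}|).+1} :=
  [ffun b => inord #|[pred x | inside mu x & F x == b]|].

Lemma contentE F b : content F b = #|[pred x | inside mu x & F x == b]| :> nat.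
Proof. by rewrite ffunE inordK // ltnS max_card. Qed.

Lemma sum_content F (h : A -> nat) :
  \sum_(x | inside mu x) h (F x) = \sum_b content F b * h b.
Proof.
rewrite (partition_big F xpredT) //=; apply: eq_bigr => b _.
rewrite contentE -sum_nat_const; apply: eq_big => [x|x /andP[_ /eqP ->] //].
by rewrite inE.
Qed.

(** Peeling off letters from the largest down gives strip chains whose sizes are the values of [c]
    in the order of [lt]. By [strip_chains_perm] they may be listed along [enum A], which does not
    involve [lt]. *)
Lemma card_tableau_content lt (c : {ffun A -> 'I_(#|{: cell n}|).+1}) : strict_total lt ->
  #|[set F | tableau a0 (inside mu) lt F & content F == c]| =
  strip_chains [seq nat_of_ord (c a) | a <- enum A] mu.
Proof.
move=> /decreasing_enumeration[s [us sA se]].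
have p : perm_eq (enum A) s.
  by apply: uniq_perm; rewrite ?enum_uniq // => a; rewrite mem_enum sA.
rewrite (strip_chains_perm (perm_map _ p)) -(card_filling a0 (fun a => c a)) //.
apply: eq_card => F; rewrite !inE /filling.
have -> : tableau a0 (inside mu) (index_gt s) F = tableau a0 (inside mu) lt F.
  by rewrite /tableau; congr [&& _, _ & _];
     apply: eq_forallb => x; apply: eq_forallb => y; rewrite se.
congr (_ && _); apply/eqP/andP => [<-|[_ /allP H]].
  by split; [apply/forallP => x; rewrite sA implybT | apply/allP => b _; rewrite contentE].
by apply/ffunP => b; apply: val_inj; rewrite /= contentE (eqP (H b (sA b))).
Qed.

Lemma card_tableau_order lt lt' (Q : pred {ffun A -> 'I_(#|{: cell n}|).+1}) :
  strict_total lt -> strict_total lt' ->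
  #|[set F | tableau a0 (inside mu) lt F & Q (content F)]| =
  #|[set F | tableau a0 (inside mu) lt' F & Q (content F)]|.
Proof.
have E l : strict_total l -> #|[set F | tableau a0 (inside mu) l F & Q (content F)]| =
    \sum_(c | Q c) strip_chains [seq nat_of_ord (c a) | a <- enum A] mu.
  move=> st; rewrite -sum1_card (partition_big content Q) => [|F]; last by rewrite inE => /andP[].
  apply: eq_bigr => c Qc; rewrite -(card_tableau_content c st) -sum1_card.
  apply: eq_bigl => F; rewrite !inE -andbA; congr (_ && _).
  by case: eqP => [->|]; rewrite ?Qc ?andbF.
by move=> st st'; rewrite !E.
Qed.

End OrderIndependence.

Lemma tableau_eq_shape n (A : eqType) (a0 : A) (S S' : pred (cell n)) lt F :
  S =1 S' -> tableau a0 S lt F = tableau a0 S' lt F.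
Proof.
move=> e; rewrite /tableau; congr [&& _, _ & _]; apply: eq_forallb => x; rewrite ?e //;
  by apply: eq_forallb => y; rewrite !e.
Qed.

Section Schur.
Variables (n k : nat) (la : seq nat).
Hypothesis la_part : is_partition n la.

Definition shape_of : {ffun 'I_n -> 'I_n.+1} := [ffun i : 'I_n => inord (nth 0 la i)].

Lemma shape_ofE i : shape_of i = nth 0 la i :> nat.
Proof. by rewrite ffunE inordK // ltnS (nth_part_le la_part). Qed.

Lemma inside_shape_of : inside shape_of =1 @in_shape la n.
Proof. by move=> x; rewrite /inside shape_ofE. Qed.

Lemma decreasing_shape_of : decreasing shape_of.
Proof.
apply/forallP => i; rewrite shape_ofE.
have nthS : nth 0 la i.+1 <= nth 0 la i.
  case: (ltnP i.+1 (size la)) => [lt|ge]; last by rewrite nth_default.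
  case/and3P: la_part => /(sortedP 0) H _ _; exact: H.
case: (ltnP i.+1 n) => iN; last by rewrite part_out.
by rewrite -[i.+1]/(val (Ordinal iN)) part_ord shape_ofE.
Qed.

Lemma schur_coefE (e : 'I_k.+1 -> nat) : schur_coef n la e =
  \sum_(T : {ffun cell n -> 'I_n.+1} | is_SYT la T)
    \sum_(s : {ffun 'I_k -> 'S_n}) \prod_(t < k.+1)
      #|[set x : {ffun 'I_n -> 'I_(e t).+1} |
          sorts (prior_ord (des_set la T) s t) (fun a => x a) (perm_at s t) & \sum_a x a == e t]|.
Proof.
set D := \sum_(t < k.+1) e t.
have eD t : e t <= D by rewrite /D (bigD1 t) //= leq_addr.
transitivity #|[set F : {ffun cell n -> {ffun 'I_k.+1 -> 'I_D.+1}} |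
    tableau [ffun=> ord0] (fun x => in_shape la x) (@colex_lt k.+1 D.+1) F &
             [forall t, \sum_(x : cell n | in_shape la x) F x t == e t]]|; last first.
  rewrite (card_ssyt_standardization _ la_part); apply: eq_bigr => T _.
  rewrite card_increasing_rows; apply: eq_bigr => s _; apply: eq_bigr => t _.
  have st := strict_total_prior_ord (des_set la T) s (ltn_ord t).
  (* The bound on the entries changes from [D] to [e t] by passing through the increments. *)
  by rewrite (card_sorted_columns _ st (eD t) (leqnn _)) -(@card_sorted_columns _ _ _ st (e t)).
pose Q (c : {ffun {ffun 'I_k.+1 -> 'I_D.+1} -> 'I_(#|{: cell n}|).+1}) :=
  [forall t, \sum_b c b * b t == e t].
have QE (F : {ffun cell n -> {ffun 'I_k.+1 -> 'I_D.+1}}) :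
    Q (content shape_of F) = [forall t, \sum_(x : cell n | in_shape la x) F x t == e t].
  apply: eq_forallb => t; rewrite -(sum_content shape_of F (fun b => b t)).
  by congr (_ == _); apply: eq_bigl => x; rewrite inside_shape_of.
have tabE lt (F : {ffun cell n -> {ffun 'I_k.+1 -> 'I_D.+1}}) :
    tableau [ffun=> ord0] (fun x => in_shape la x) lt F =
    tableau [ffun=> ord0] (inside shape_of) lt F.
  by apply: tableau_eq_shape => x; rewrite inside_shape_of.
transitivity #|[set F : {ffun cell n -> {ffun 'I_k.+1 -> 'I_D.+1}} |
    tableau [ffun=> ord0] (inside shape_of)
      (fun u v => lex_lt (entry_seq u) (entry_seq v)) F & Q (content shape_of F)]|.
  apply: eq_card => F; rewrite !inE QE; congr (_ && _).
  rewrite -tabE /is_SSYT /tableau; congr [&& _, _ & _].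
    apply: eq_forallb => x; congr (_ ==> _).
    apply/forallP/eqP => [H|-> t]; last by rewrite ffunE.
    by apply/ffunP => t; apply: val_inj; rewrite ffunE (eqP (H t)).
  apply: eq_forallb => x; apply: eq_forallb => y.
  by rewrite /lex_le (inj_eq (@entry_seq_inj _ _)).
rewrite (card_tableau_order _ decreasing_shape_of Q
  (strict_total_lex _ _) (strict_total_colex _ _)).
by apply: eq_card => F; rewrite !inE QE tabE.
Qed.

End Schur.

Lemma prod_bool_natr (R : comNzRingType) (I : finType) (b : pred I) :
  (\prod_i (b i)%:R = [forall i, b i]%:R :> R)%R.
Proof.
case: (boolP [forall i, b i]) => [/forallP H|]; first by rewrite big1 // => i _; rewrite H.
by rewrite negb_forall => /existsP[i /negbTE bi]; rewrite (bigD1 i) //= bi mul0r.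
Qed.

Theorem theorem2 (n k : nat) (la : seq nat) :
  1 <= n -> 1 <= k -> is_partition n la ->
  forall d : 'I_k -> nat,
    @ps_mul k (@schur_ps n k la) (@qpoch_den n k) d = @syt_num_ps n k la d.
Proof.
case: k => // k _ _ la_part d; rewrite /ps_mul /schur_ps /syt_num_ps /qpoch_den.
have dD t : d t <= \sum_(t < k.+1) d t by rewrite (bigD1 t) //= leq_addr.
rewrite /syt_num_coef (card_pairs (fun T : {ffun cell n -> 'I_n.+1} => is_SYT la T)
  (fun T (s : {ffun 'I_k -> 'S_n}) =>
  [forall t : 'I_k.+1, nth 0 (comaj_vec n (des_set la T)
     [seq perm_word (s j) | j <- enum 'I_k]) t == d t])) -natz natr_sum.
under [LHS]eq_bigr => e _ do rewrite schur_coefE // -natz natr_sum mulr_suml.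
rewrite (exchange_big_dep (fun T => is_SYT la T)) //=; apply: eq_bigr => T Ts.
under [LHS]eq_bigr => e _ do rewrite natr_sum mulr_suml.
rewrite exchange_big /= -sum1_card natr_sum [RHS]big_mkcond /=; apply: eq_bigr => s _.
under [LHS]eq_bigr => e _ do rewrite natr_prod -big_split /=.
(* For fixed [T] and [s] the convolution factors over the variables; each factor is then 1 if [d t]
   is the comaj of step [t] and 0 otherwise. *)
transitivity (\prod_(t < k.+1) \sum_(m < (\sum_(t < k.+1) d t).+1 | (m <= d t)%N)
    (#|[set x : {ffun 'I_n -> 'I_m.+1} |
        sorts (prior_ord (des_set la T) s t) (fun a => x a) (perm_at s t) & (\sum_a x a == m)%N]|%:R
     * (qpoch n)`_(d t - m)) : int)%R.
  rewrite bigA_distr_big_dep /=; apply: eq_bigl => e.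
  by rewrite Ts andbT; apply/forallP/familyP.
under [LHS]eq_bigr => t _ do
  rewrite (card_sorted_columns_qpoch _
    (strict_total_prior_ord (des_set la T) s (ltn_ord t)) (dD t)).
rewrite prod_bool_natr inE.
under [in RHS]eq_forallb => t do rewrite comaj_vecE eq_sym.
by case: [forall t, _].
Qed.
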